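(* Let $X$, $U$ be Banach spaces and let $\mathcal{U}:=L^p(\mathbb{R}^+_0,U)$ for some $p\in[1,\infty)\cup\{\infty\}$, with norm $\|\cdot\|_{\mathcal{U}}=\|\cdot\|_p$. Let $A$ be the generator of a (strongly continuous) semigroup on $X$ and let $B\in L(U,X_{-1})$ be a $\mathcal{U}$-admissible control operator for $A$, that is, $$\Phi_t(u):=\int_0^t e^{A_{-1}(t-s)}Bu(s)\,ds\in X\qquad(t\in\mathbb{R}^+_0\text{ and }u\in\mathcal{U}).$$ In case $p=\infty$, additionally assume that $t\mapsto\Phi_t(u)\in X$ is continuous for every $u\in\mathcal{U}$. Then $\mathfrak{S}:=(X,\mathcal{U},\varphi)$ with $$\varphi(t,x_0,u):=e^{At}x_0+\int_0^t e^{A_{-1}(t-s)}Bu(s)\,ds\qquad((t,x_0,u)\in\mathbb{R}^+_0\times X\times\mathcal{U})$$ is a dynamical system with inputs, and $\mathfrak{S}$ is weakly input-to-state stable if and only if it is zero-input uniformly locally stable and of weak asymptotic gain.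
   Context: Notation: $\mathbb{R}^+_0=[0,\infty)$; $\|\cdot\|_p$ is the standard norm on $L^p(\mathbb{R}^+_0,U)$ (functions identified when equal almost everywhere). $(e^{At})_{t\ge0}$ denotes the semigroup generated by $A$. The extrapolation space $X_{-1}$ of $A$ is the completion of $X$ with respect to the norm $\|(\lambda-A)^{-1}\cdot\|$ for some (any) $\lambda$ in the resolvent set of $A$; the semigroup $e^{A\cdot}$ extends uniquely to a strongly continuous semigroup on $X_{-1}$, whose generator is denoted $A_{-1}$. $L(U,X_{-1})$ denotes the bounded linear operators from $U$ to $X_{-1}$; the integral is taken in $X_{-1}$. $\mathcal{K}$ is the set of continuous strictly increasing functions $\gamma:\mathbb{R}^+_0\to\mathbb{R}^+_0$ with $\gamma(0)=0$. For functions $u_1,u_2$ on $\mathbb{R}^+_0$ and $\tau\in\mathbb{R}^+_0$, the concatenation $u_1\,\&_\tau u_2$ is defined by $(u_1\,\&_\tau u_2)(t)=u_1(t)$ for $t\in[0,\tau)$ and $=u_2(t-\tau)$ for $t\ge\tau$. Dynamical system with inputs: a triple $\mathfrak{S}=(X,\mathcal{U},\varphi)$, where $X$ is a normed linear space with norm $\|\cdot\|$; $\mathcal{U}$ is a non-empty set of functions $u:\mathbb{R}^+_0\to U$ endowed with a norm $\|\cdot\|_{\mathcal{U}}$ (meaning the restriction to $\mathcal{U}$ of a norm on some linear space containing $\mathcal{U}$); and $\varphi:\mathbb{R}^+_0\times X\times\mathcal{U}\to X$ is a map, such that: (1) $u(\cdot+\tau)\in\mathcal{U}$ and $\|u(\cdot+\tau)\|_{\mathcal{U}}\le\|u\|_{\mathcal{U}}$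 for all $u\in\mathcal{U}$, $\tau\ge0$; (2) $u_1\,\&_\tau u_2\in\mathcal{U}$ for all $u_1,u_2\in\mathcal{U}$, $\tau\ge0$; (3) $\varphi(0,x_0,u)=x_0$ and $\varphi(t+s,x_0,u)=\varphi(t,\varphi(s,x_0,u),u(\cdot+s))$ for all $(x_0,u)\in X\times\mathcal{U}$, $s,t\ge0$; (4) $\varphi(\cdot,x_0,u):\mathbb{R}^+_0\to X$ is continuous for all $(x_0,u)$; (5) if $u_1|_{[0,\tau]}=u_2|_{[0,\tau]}$, then $\varphi(\cdot,x_0,u_1)|_{[0,\tau]}=\varphi(\cdot,x_0,u_2)|_{[0,\tau]}$, for all $x_0\in X$, $u_1,u_2\in\mathcal{U}$, $\tau\ge0$. Stability notions for $\mathfrak{S}$: - Uniformly globally stable: there exist $\underline\sigma,\underline\gamma\in\mathcal{K}$ such that ( * ) $\|\varphi(t,x_0,u)\|\le\underline\sigma(\|x_0\|)+\underline\gamma(\|u\|_{\mathcal{U}})$ for all $t\ge0$, holds for all $(x_0,u)\in X\times\mathcal{U}$. - Uniformly locally stable: there exist $\underline\sigma,\underline\gamma\in\mathcal{K}$ and $r>0$ such that ( * ) holds for all $(x_0,u)\in X\times\mathcal{U}$ with $\|x_0\|\le r$ and $\|u\|_{\mathcal{U}}\le r$. - Zero-input uniformly locally stable: $0\in\mathcal{U}$ and the restricted system $(X,\{0\},\varphi)$ is uniformly locally stable. - Of weak asymptotic gain: there is $\overline\gamma\in\mathcal{K}\cup\{0\}$ such that for every $\varepsilon>0$ and $(x_0,u)\in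 X\times\mathcal{U}$ there is $\overline\tau(\varepsilon,x_0,u)\in\mathbb{R}^+_0$ with $\|\varphi(t,x_0,u)\|\le\varepsilon+\overline\gamma(\|u\|_{\mathcal{U}})$ for all $t\ge\overline\tau(\varepsilon,x_0,u)$. - Weakly input-to-state stable: uniformly globally stable and of weak asymptotic gain. *)

(* Defs.v *)
From HB Require Import structures.
From mathcomp Require Import all_boot all_order all_algebra.
From mathcomp Require Import all_classical all_reals all_analysis.

Set Implicit Arguments.
Unset Strict Implicit.
Unset Printing Implicit Defensive.

Import Order.TTheory GRing.Theory Num.Theory.
Import numFieldNormedType.Exports.

Local Open Scope classical_set_scope.
Local Open Scope ring_scope.

(** * Bochner integral *)

Definition simple_function {d : measure_display} {T : measurableType d}
    {R : realType} {Y : normedModType R} (s : T -> Y) : Prop :=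
  finite_set (range s) /\ forall y, measurable (s @^-1` [set y]).

Definition strongly_measurable {d : measure_display} {T : measurableType d}
    {R : realType} {Y : normedModType R} (mu : {measure set T -> \bar R})
    (D : set T) (f : T -> Y) : Prop :=
  exists s : nat -> T -> Y, (forall n, simple_function (s n)) /\
    {ae mu, forall x, D x -> (fun n => s n x) @ \oo --> f x}.

Definition integrable_simple {d : measure_display} {T : measurableType d}
    {R : realType} {Y : normedModType R} (mu : {measure set T -> \bar R})
    (D : set T) (s : T -> Y) : Prop :=
  simple_function s /\
  forall y, y != 0 -> (mu (D `&` s @^-1` [set y]) < +oo)%E.

(* The summand vanishes at y = 0, even where the level set has infinite
   measure (then fine +oo = 0 as well). *)
Definition simple_integral {d : measure_display} {T : measurableType d}
    {R : realType} {Y : normedModType R} (mu : {measure set T -> \bar R})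
    (D : set T) (s : T -> Y) : Y :=
  \sum_(y \in range s) fine (mu (D `&` s @^-1` [set y])) *: y.

Definition has_Bochner_integral {d : measure_display} {T : measurableType d}
    {R : realType} {Y : normedModType R} (mu : {measure set T -> \bar R})
    (D : set T) (f : T -> Y) (I : Y) : Prop :=
  exists s : nat -> T -> Y,
    [/\ forall n, integrable_simple mu D (s n),
        {ae mu, forall x, D x -> (fun n => s n x) @ \oo --> f x},
        (fun n => \int[mu]_(x in D) (`|f x - s n x|%:E))%E @ \oo --> 0%E &
        (fun n => simple_integral mu D (s n)) @ \oo --> I].

(* Total version; the value is 0 for functions that are not integrable. *)
Definition Bochner_integral {d : measure_display} {T : measurableType d}
    {R : realType} {Y : normedModType R} (mu : {measure set T -> \bar R})
    (D : set T) (f : T -> Y) : Y :=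
  xget 0 [set I | has_Bochner_integral mu D f I].

(** * Inputs on the half-line *)

(* A function on [0, +oo[ is represented by a function on R whose values at
   negative arguments are irrelevant, and functions are identified when they
   are equal almost everywhere: equality of two inputs on a set D of times is
   the relation [input_eq D], and equality of inputs is
   [input_eq `[0, +oo[]. *)
Definition input_eq {R : realType} {U : Type} (D : set R) (u v : R -> U) :
    Prop :=
  {ae (@lebesgue_measure R), forall t, D t -> u t = v t}.

Definition Lp_enorm {R : realType} {U : normedModType R} (p : \bar R)
    (u : R -> U) : \bar R :=
  Lnorm (@lebesgue_measure R) p ((fun t : R => `|u t|%:E) \_ `[0, +oo[).

Definition in_Lp {R : realType} {U : normedModType R} (p : \bar R) :
    set (R -> U) :=
  [set u | strongly_measurable (@lebesgue_measure R) `[0, +oo[ u /\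
    (Lp_enorm p u < +oo)%E].

Definition Lp_norm {R : realType} {U : normedModType R} (p : \bar R)
    (u : R -> U) : R :=
  fine (Lp_enorm p u).

Definition shift_input {R : realType} {U : Type} (tau : R) (u : R -> U) :
    R -> U :=
  fun t => u (t + tau).

Definition concat_input {R : realType} {U : Type} (tau : R) (u1 u2 : R -> U) :
    R -> U :=
  fun t => if t < tau then u1 t else u2 (t - tau).

(** * Dynamical systems with inputs and their stability *)

(* N is a norm on the linear space of the classes of elements of V. *)
Definition is_norm_on {R : realType} {U : lmodType R} (V : set (R -> U))
    (N : (R -> U) -> R) : Prop :=
  [/\ [/\ V (fun=> 0),
          forall u v, V u -> V v -> V (fun t => u t + v t) &
          forall a u, V u -> V (fun t => a *: u t)],
      forall u v, V u -> V v -> input_eq `[0, +oo[ u v -> N u = N v,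
      forall u v, V u -> V v -> N (fun t => u t + v t) <= N u + N v,
      forall a u, V u -> N (fun t => a *: u t) = `|a| * N u &
      forall u, V u -> N u = 0 -> input_eq `[0, +oo[ u (fun=> 0)].

(* [causal] with tau := t also says that phi t x0 is well defined on inputs
   modulo almost-everywhere equality. *)
Record dynamical_system {R : realType} {X : normedModType R} {U : lmodType R}
    (Uu : set (R -> U)) (N : (R -> U) -> R) (phi : R -> X -> (R -> U) -> X) :
    Prop := DynamicalSystem {
  inputs_nonempty : Uu !=set0 ;
  inputs_normed : exists V : set (R -> U), Uu `<=` V /\ is_norm_on V N ;
  shift_closed : forall u (tau : R), Uu u -> 0 <= tau ->
    Uu (shift_input tau u) /\ N (shift_input tau u) <= N u ;
  concat_closed : forall u1 u2 (tau : R), Uu u1 -> Uu u2 -> 0 <= tau ->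
    Uu (concat_input tau u1 u2) ;
  flow_initial : forall x0 u, Uu u -> phi 0 x0 u = x0 ;
  flow_cocycle : forall x0 u (s t : R), Uu u -> 0 <= s -> 0 <= t ->
    phi (t + s) x0 u = phi t (phi s x0 u) (shift_input s u) ;
  flow_continuous : forall x0 u, Uu u ->
    {within `[0, +oo[, continuous (fun t : R => phi t x0 u)} ;
  causal : forall x0 u1 u2 (tau : R), Uu u1 -> Uu u2 -> 0 <= tau ->
    input_eq `[0, tau] u1 u2 ->
    forall t : R, 0 <= t <= tau -> phi t x0 u1 = phi t x0 u2
}.

(* The inclusion of the range in [0, +oo[ follows from the other clauses. *)
Definition class_K {R : realType} (gamma : R -> R) : Prop :=
  [/\ {within `[0, +oo[, continuous gamma},
      {in `[0, +oo[ &, {homo gamma : r s / r < s}} &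
      gamma 0 = 0].

Definition class_K0 {R : realType} (gamma : R -> R) : Prop :=
  class_K gamma \/ forall r : R, 0 <= r -> gamma r = 0.

Definition stability_bound {R : realType} {X : normedModType R} {U : Type}
    (N : (R -> U) -> R) (phi : R -> X -> (R -> U) -> X) (sigma gamma : R -> R)
    (x0 : X) (u : R -> U) : Prop :=
  forall t : R, 0 <= t -> `|phi t x0 u| <= sigma `|x0| + gamma (N u).

Definition uniformly_globally_stable {R : realType} {X : normedModType R}
    {U : Type} (Uu : set (R -> U)) (N : (R -> U) -> R)
    (phi : R -> X -> (R -> U) -> X) : Prop :=
  exists sigma gamma, [/\ class_K sigma, class_K gamma &
    forall x0 u, Uu u -> stability_bound N phi sigma gamma x0 u].

Definition uniformly_locally_stable {R : realType} {X : normedModType R}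
    {U : Type} (Uu : set (R -> U)) (N : (R -> U) -> R)
    (phi : R -> X -> (R -> U) -> X) : Prop :=
  exists sigma gamma r, [/\ class_K sigma, class_K gamma, 0 < r &
    forall x0 u, Uu u -> `|x0| <= r -> N u <= r ->
      stability_bound N phi sigma gamma x0 u].

Definition zero_input_uniformly_locally_stable {R : realType}
    {X : normedModType R} {U : lmodType R} (Uu : set (R -> U))
    (N : (R -> U) -> R) (phi : R -> X -> (R -> U) -> X) : Prop :=
  Uu (fun=> 0) /\ uniformly_locally_stable [set (fun=> 0)] N phi.

Definition weak_asymptotic_gain {R : realType} {X : normedModType R}
    {U : Type} (Uu : set (R -> U)) (N : (R -> U) -> R)
    (phi : R -> X -> (R -> U) -> X) : Prop :=
  exists2 gamma, class_K0 gamma &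
    forall (eps : R) x0 u, 0 < eps -> Uu u ->
      exists2 tau : R, 0 <= tau &
        forall t : R, tau <= t -> `|phi t x0 u| <= eps + gamma (N u).

Definition weakly_ISS {R : realType} {X : normedModType R} {U : Type}
    (Uu : set (R -> U)) (N : (R -> U) -> R) (phi : R -> X -> (R -> U) -> X) :
    Prop :=
  uniformly_globally_stable Uu N phi /\ weak_asymptotic_gain Uu N phi.

(** * Semigroups, generators and the extrapolation space *)

(* Scalars are real. Complex Banach spaces are covered by restriction of
   scalars: the norm, the semigroup and its generator do not change, and
   neither does the extrapolation space, since the resolvent set of a generator
   contains real points and the choice of the point is immaterial. *)

Record C0_semigroup {R : realType} {Y : normedModType R}
    (T : R -> {linear Y -> Y}) : Prop := C0Semigroup {
  semigroup_bounded : forall t : R, 0 <= t -> continuous (T t) ;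
  semigroup0 : forall y, T 0 y = y ;
  semigroupD : forall (s t : R) y, 0 <= s -> 0 <= t -> T (s + t) y = T s (T t y) ;
  semigroup_strongly_continuous : forall y, T t y @[t --> 0^'+] --> y
}.

(* An unbounded operator is given by its domain DA and a function A of which
   only the values on DA matter. *)
Definition is_generator {R : realType} {X : normedModType R}
    (T : R -> {linear X -> X}) (DA : set X) (A : X -> X) : Prop :=
  forall x y, DA x /\ A x = y <->
    h^-1 *: (T h x - x) @[h --> 0^'+] --> y.

(* lambda is in the resolvent set of A and Rl = (lambda - A)^-1. *)
Definition is_resolvent {R : realType} {X : normedModType R}
    (DA : set X) (A : X -> X) (lambda : R) (Rl : {linear X -> X}) : Prop :=
  [/\ continuous Rl,
      forall y, DA (Rl y) /\ lambda *: Rl y - A (Rl y) = y &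
      forall x, DA x -> Rl (lambda *: x - A x) = x].

(* (Xm, j) is a completion of X for the norm |(lambda - A)^-1 x|. *)
Definition is_extrapolation_space {R : realType} {X : normedModType R}
    {Xm : completeNormedModType R} (Rl : X -> X) (j : {linear X -> Xm}) :
    Prop :=
  (forall x, `|j x| = `|Rl x|) /\ dense (range j).

(* Tm is the strongly continuous extension of T to the completion Xm. *)
Definition is_extended_semigroup {R : realType} {X : normedModType R}
    {Xm : completeNormedModType R} (j : X -> Xm) (T : R -> {linear X -> X})
    (Tm : R -> {linear Xm -> Xm}) : Prop :=
  C0_semigroup Tm /\ forall (t : R) x, 0 <= t -> Tm t (j x) = j (T t x).

(** * Linear control systems *)

(* The integral, taken in Xm, that defines Phi_t(u). *)
Definition input_integral {R : realType} {U : normedModType R}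
    {Xm : completeNormedModType R} (Tm : R -> {linear Xm -> Xm})
    (B : U -> Xm) (t : R) (u : R -> U) : Xm :=
  Bochner_integral (@lebesgue_measure R) `[0, t]
    (fun s => Tm (t - s) (B (u s))).

Definition admissible {R : realType} {X U : normedModType R}
    {Xm : completeNormedModType R} (j : X -> Xm)
    (Tm : R -> {linear Xm -> Xm}) (Uu : set (R -> U)) (B : U -> Xm) : Prop :=
  forall (t : R) u, 0 <= t -> Uu u -> range j (input_integral Tm B t u).

(* Phi_t(u) as an element of X, through the embedding j; the default 0 is not
   used when B is admissible. *)
Definition input_map {R : realType} {X U : normedModType R}
    {Xm : completeNormedModType R} (j : X -> Xm)
    (Tm : R -> {linear Xm -> Xm}) (B : U -> Xm) (t : R) (u : R -> U) : X :=
  xget 0 [set x | j x = input_integral Tm B t u].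

Definition mild_flow {R : realType} {X U : normedModType R}
    {Xm : completeNormedModType R} (T : R -> {linear X -> X}) (j : X -> Xm)
    (Tm : R -> {linear Xm -> Xm}) (B : U -> Xm)
    (t : R) (x0 : X) (u : R -> U) : X :=
  T t x0 + input_map j Tm B t u.

(* Main.v *)
Require Import Defs.
From HB Require Import structures.
From mathcomp Require Import all_boot all_order all_algebra.
From mathcomp Require Import all_classical all_reals all_analysis.
From mathcomp Require Import measurable_realfun ess_sup_inf lra.

Set Implicit Arguments.
Unset Strict Implicit.
Unset Printing Implicit Defensive.

Import Order.TTheory GRing.Theory Num.Theory.
Import numFieldNormedType.Exports.

Local Open Scope classical_set_scope.
Local Open Scope ring_scope.

(** The flow is [T t x0 + Phi t u], where [Phi t u] is the input integral, and
    it is linear in the pair of [x0] and [u]. The substantial implication is an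
    instance of the uniform boundedness principle. By homogeneity, stability
    near the origin for the zero input bounds the operators [T t]. For a single
    input [u], the weak asymptotic gain from the initial state [0] bounds
    [Phi t u] for large [t], and on bounded time intervals it is bounded anyway.
    Hence the operators [Phi t] from L^p to [X] are pointwise bounded, so
    uniformly bounded ([Lp_uniform_boundedness]), and the flow obeys a bound
    that is linear in the norms of [x0] and [u] ([weakly_ISS_equiv]).

    This needs each [Phi t] to be bounded into [X], whereas the integral only
    provides a bound in the larger space [Xm]. As [`|j x| = `|Rl x|], that bound
    controls [Rl (Phi t u)], and [x] is the limit of
    [lambda *: Rl x - n *: (T n^-1 (Rl x) - Rl x)] by the definition of the
    generator ([resolvent_approx]). So [Phi t] is a pointwise limit of bounded
    operators, and the uniform boundedness principle applies a first time
    ([input_map_bounded_at]).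

    For the axioms of a dynamical system, the cocycle law comes from splitting
    the integral at an intermediate time ([input_integral_cocycle]). Continuity
    in time for finite [p] comes from the identity
    [Phi (t + h) (delay h u) = Phi t u], the bound on [Phi] and the continuity of
    translations in L^p ([vLnorm_translation_continuous]).

    The integration theory is built on everywhere defined pointwise limits of
    simple functions; an input is replaced by such a representative outside a
    null set. By Pettis' criterion ([simple_limitP]) this class is closed under
    pointwise limits. With Fatou's lemma this yields the completeness of L^p
    ([vLnorm_series]) on which Sokal's proof of the uniform boundedness
    principle ([uniform_boundedness]) rests. *)

(** * Simple functions and their pointwise limits *)

Section simple_functions.
Context {d : measure_display} {T : measurableType d} {R : realType}.
Implicit Types Y Z W : normedModType R.

Lemma simple_preimage Y (s : T -> Y) (A : set Y) :
  simple_function s -> measurable (s @^-1` A).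
Proof.
move=> [fs ms].
have -> : s @^-1` A = \bigcup_(y in range s `&` A) s @^-1` [set y].
  apply/seteqP; split=> [x /= Asx|x [y [_ Ay]] /= ->//].
  by exists (s x) => //; split=> //; exists x.
by apply: fin_bigcup_measurable => //; exact: finite_setIl.
Qed.

Lemma simple_cst Y (y : Y) : simple_function (fun _ : T => y).
Proof.
split=> [|z]; first by apply: sub_finite_set (finite_set1 y) => _ [x _ <-].
by have := @measurable_cst _ _ T T; rewrite preimage_cst; case: ifP.
Qed.

Lemma simple_comp2 Y Z W (g : Y -> Z -> W) (s : T -> Y) (s' : T -> Z) :
  simple_function s -> simple_function s' ->
  simple_function (fun x => g (s x) (s' x)).
Proof.
move=> ss ss'; split=> [|w].
  apply: sub_finite_set (finite_image2 g ss.1 ss'.1) => _ [x _ <-].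
  by exists (s x); [exists x|exists (s' x) => //; exists x].
rewrite (_ : _ @^-1` _ = \bigcup_(y in range s)
    (s @^-1` [set y] `&` s' @^-1` [set z | g y z = w])).
  apply: fin_bigcup_measurable; first exact: ss.1.
  by move=> y _; apply: measurableI; exact: simple_preimage.
apply/seteqP; split=> [x /= <-|x [y _] [/= -> //]].
by exists (s x) => //; exists x.
Qed.

Lemma simple_comp Y Z (g : Y -> Z) (s : T -> Y) :
  simple_function s -> simple_function (g \o s).
Proof. by move=> ss; exact: (simple_comp2 (fun y _ => g y) ss ss). Qed.

Lemma simple_patch Y (D : set T) (s s' : T -> Y) : measurable D ->
  simple_function s -> simple_function s' -> simple_function (patch s' D s).
Proof.
move=> mD ss ss'; split=> [|y].
  apply: (@sub_finite_set _ _ (range s `|` range s')).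
    by move=> _ [x _ <-]; rewrite /patch; case: ifP => _; [left|right]; exists x.
  by rewrite finite_setU; split; [exact: ss.1|exact: ss'.1].
rewrite (_ : _ @^-1` _ =
    (D `&` s @^-1` [set y]) `|` (~` D `&` s' @^-1` [set y])).
  apply: measurableU; apply: measurableI => //; last 2 first.
  - exact: measurableC.
  - exact: simple_preimage.
  - exact: simple_preimage.
apply/seteqP; split=> x /=; rewrite /patch.
  by case: ifPn; rewrite ?inE ?notin_setE => Dx <-; [left|right].
by move=> [[Dx <-]|[Dx <-]]; [rewrite ifT ?inE|rewrite ifF// memNset].
Qed.

Lemma simple_measurable_fun (s : T -> R) :
  simple_function s -> measurable_fun [set: T] s.
Proof. by move=> ss _ A _; rewrite setTI; exact: simple_preimage. Qed.

Definition simple_limit Y (f : T -> Y) : Prop :=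
  exists s : nat -> T -> Y, (forall n, simple_function (s n)) /\
    forall x, s n x @[n --> \oo] --> f x.

Lemma simple_simple_limit Y (s : T -> Y) : simple_function s -> simple_limit s.
Proof. by move=> ss; exists (fun=> s); split=> // x; exact: cvg_cst. Qed.

Lemma simple_limit_comp2 Y Z W (g : Y -> Z -> W) (f : T -> Y) (f' : T -> Z) :
  continuous (fun yz => g yz.1 yz.2) -> simple_limit f -> simple_limit f' ->
  simple_limit (fun x => g (f x) (f' x)).
Proof.
move=> cg [s [ss sf]] [s' [ss' sf']]; exists (fun n x => g (s n x) (s' n x)).
split=> [n|x]; first exact: simple_comp2.
exact: (cvg_comp2 (sf x) (sf' x) (cg (f x, f' x))).
Qed.

Lemma simple_limit_comp Y Z (g : Y -> Z) (f : T -> Y) :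
  continuous g -> simple_limit f -> simple_limit (g \o f).
Proof.
move=> cg [s [ss sf]]; exists (fun n => g \o s n); split=> [n|x].
  exact: simple_comp.
exact: (continuous_cvg _ (cg (f x)) (sf x)).
Qed.

Lemma simple_limitD Y (f g : T -> Y) : simple_limit f -> simple_limit g ->
  simple_limit (fun x => f x + g x).
Proof. by apply: simple_limit_comp2; exact: add_continuous. Qed.

Lemma simple_limitB Y (f g : T -> Y) : simple_limit f -> simple_limit g ->
  simple_limit (fun x => f x - g x).
Proof.
move=> sf sg; apply: simple_limitD => //.
by apply: (@simple_limit_comp _ _ -%R) => //; exact: opp_continuous.
Qed.

Lemma simple_limitZ Y (a : R) (f : T -> Y) : simple_limit f ->
  simple_limit (fun x => a *: f x).
Proof. by apply: simple_limit_comp; exact: scaler_continuous. Qed.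

Lemma simple_limit_sum Y (v : nat -> T -> Y) m n :
  (forall k, simple_limit (v k)) ->
  simple_limit (fun x => \sum_(m <= k < n) v k x).
Proof.
move=> sv; elim: n => [|n ih].
  under eq_fun do rewrite big_geq//.
  exact/simple_simple_limit/simple_cst.
have [mn|nm] := leqP m n.
  under eq_fun do rewrite big_nat_recr//=.
  exact: simple_limitD.
under eq_fun do rewrite big_geq//.
exact/simple_simple_limit/simple_cst.
Qed.

Lemma simple_limit_patch Y (D : set T) (f g : T -> Y) : measurable D ->
  simple_limit f -> simple_limit g -> simple_limit (patch g D f).
Proof.
move=> mD [s [ss sf]] [s' [ss' sg]]; exists (fun n => patch (s' n) D (s n)).
split=> [n|x]; first exact: simple_patch.
by rewrite /patch; case: ifPn => _.
Qed.

Lemma simple_limit_measurable_norm Y (f : T -> Y) :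
  simple_limit f -> measurable_fun [set: T] (fun x => `|f x|).
Proof.
move=> [s [ss sf]].
apply: (@measurable_fun_cvg _ _ _ _ (fun n x => `|s n x|)) => [n|x _].
  exact/simple_measurable_fun/simple_comp.
exact: cvg_norm.
Qed.

(** The new point is compared with the best earlier one only, so that the
    measurability of the levels follows by induction. *)
Fixpoint nearest Y (y_ : nat -> Y) (f : T -> Y) (n : nat) (x : T) : Y :=
  if n is m.+1 then
    if `|f x - y_ m.+1| < `|f x - nearest y_ f m x| then y_ m.+1
    else nearest y_ f m x
  else y_ 0.

Lemma nearest_le Y (y_ : nat -> Y) (f : T -> Y) n i x : (i <= n)%N ->
  `|f x - nearest y_ f n x| <= `|f x - y_ i|.
Proof.
elim: n => [|n ih] /=; first by rewrite leqn0 => /eqP ->.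
rewrite leq_eqVlt => /predU1P[->|/ih {}ih]; first by case: ltP => // /ltW.
by case: ltP => // /ltW /le_trans; apply.
Qed.

Lemma simple_nearest Y (y_ : nat -> Y) (f : T -> Y) n :
  (forall y, measurable_fun [set: T] (fun x => `|f x - y|)) ->
  simple_function (nearest y_ f n).
Proof.
move=> mf; elim: n => [|n ih]; first exact: simple_cst.
set D := [set x | `|f x - y_ n.+1| < `|f x - nearest y_ f n x|].
rewrite (_ : nearest _ _ _ = patch (nearest y_ f n) D (fun=> y_ n.+1)).
  apply: simple_patch => //; last exact: simple_cst.
  have mfs : measurable_fun [set: T] (fun x => `|f x - nearest y_ f n x|).
    move=> _ A mA; rewrite setTI.
    rewrite (_ : _ @^-1` _ = \bigcup_(y in range (nearest y_ f n))
        (nearest y_ f n @^-1` [set y] `&` (fun x => `|f x - y|) @^-1` A)).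
      apply: fin_bigcup_measurable => [|y _]; first exact: ih.1.
      apply: measurableI; first exact: simple_preimage.
      by rewrite -[X in measurable X]setTI; exact: mf.
    apply/seteqP; split=> [x /= Ax|x [y _] [/= -> //]].
    by exists (nearest y_ f n x) => //; exists x.
  have : measurable ([set: T] `&`
      (fun x => `|f x - y_ n.+1| < `|f x - nearest y_ f n x|) @^-1` [set true]).
    by apply: (measurable_fun_ltr (mf (y_ n.+1)) mfs).
  by rewrite setTI.
apply/funext => x /=; rewrite /patch.
by case: ltP => h; [rewrite ifT// inE|rewrite ifF// memNset//= => /lt_geF; rewrite h].
Qed.

(** Pettis' criterion: the right-hand side passes to pointwise limits, and the
    nearest points of a countable dense set are simple functions tending to
    [f]. *)
Lemma simple_limitP Y (f : T -> Y) :
  simple_limit f <->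
  (exists2 C : set Y, countable C & forall x, closure C (f x)) /\
  (forall y, measurable_fun [set: T] (fun x => `|f x - y|)).
Proof.
split=> [sf|[[C cC Cf] mf]].
  split; last first.
    move=> y; apply: simple_limit_measurable_norm; apply: simple_limitB => //.
    exact/simple_simple_limit/simple_cst.
  have [s [ss cs]] := sf; exists (\bigcup_n range (s n)).
    by apply: bigcup_countable => // n _; exact/finite_set_countable/(ss n).1.
  move=> x B /cs [N _ NB]; exists (s N x); split.
    by exists N => //; exists x.
  exact: (NB N (leqnn _)).
have /countable_injP[h hC] := cC.
pose y_ n : Y := xget 0 [set y | C y /\ h y = n].
have y_h y : C y -> y_ (h y) = y.
  move=> Cy; rewrite /y_; case: xgetP => [z _ [Cz hz]|/(_ y)[]//].
  by apply: hC; rewrite ?inE.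
exists (nearest y_ f); split=> [n|x]; first exact: simple_nearest.
apply/cvgrPdist_lt => e e0.
have [y [Cy]] := Cf x _ (nbhsx_ballx (f x) _ e0).
rewrite -ball_normE /= => fxy.
exists (h y) => // n /= hn; apply: le_lt_trans fxy.
by rewrite -[in leRHS](y_h _ Cy); exact: nearest_le.
Qed.

Lemma simple_limit_cvg Y (f_ : nat -> T -> Y) (f : T -> Y) :
  (forall n, simple_limit (f_ n)) -> (forall x, f_ n x @[n --> \oo] --> f x) ->
  simple_limit f.
Proof.
move=> sf ff; apply/simple_limitP; split.
  have /choice[C CP] n : exists C : set Y, countable C /\
      forall x, closure C (f_ n x).
    by have [[C] cC Cf _] := (simple_limitP _).1 (sf n); exists C.
  exists (\bigcup_n C n); first by apply: bigcup_countable => // n _; case: (CP n).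
  move=> x B fxB; have [N _ NB] := ff x _ (nbhs_interior fxB).
  have [y [Cy By]] := (CP N).2 x B (NB N (leqnn _)).
  by exists y; split=> //; exists N.
move=> y; apply: (@measurable_fun_cvg _ _ _ _ (fun n x => `|f_ n x - y|)).
  by move=> n; case/simple_limitP : (sf n).
by move=> x _; apply: cvg_norm; apply: cvgB => //; exact: cvg_cst.
Qed.

End simple_functions.

(** * Integrals of functions that are measurable up to a null set *)

Section ae_integral.
Context {d : measure_display} {T : measurableType d} {R : realType}.
Variable mu : {measure set T -> \bar R}.
Import HBNNSimple.

(** No measurability is assumed: the integral of a nonnegative function is a
    supremum over the simple functions below it, and setting such a function
    to zero on a null set does not change its integral. *)
Lemma ae_le_ge0_integral (D : set T) (f g : T -> \bar R) :
  (forall x, D x -> (0 <= f x)%E) -> (forall x, D x -> (0 <= g x)%E) ->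
  {ae mu, forall x, D x -> (f x <= g x)%E} ->
  (\int[mu]_(x in D) f x <= \int[mu]_(x in D) g x)%E.
Proof.
move=> f0 g0 [N [mN N0 Nfg]]; rewrite !ge0_integralE//.
apply: ge_ereal_sup => _ [h hf <-].
pose h' := proj_nnsfun h (measurableC mN).
rewrite (_ : sintegral mu h = sintegral mu h'); last first.
  rewrite -!integralT_nnsfun; apply: ae_eq_integral => //.
  - exact/measurable_EFinP.
  - exact/measurable_EFinP.
  exists N; split=> // x; apply: contra_notP => /= Nx _.
  by rewrite mindicE mem_set//= mulr1.
apply: ereal_sup_ubound; exists h' => //= x; rewrite mindicE.
have [Nx|Nx] := pselect (N x).
  rewrite memNset ?mulr0; last by [].
  by rewrite /patch; case: ifPn => //; rewrite inE; exact: g0.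
rewrite mem_set// mulr1; apply: (le_trans (hf x)); rewrite /patch.
case: ifPn => //; rewrite inE => Dx.
by apply: contrapT => fg; apply/Nx/Nfg => /=; apply: contra_not fg; exact.
Qed.

Lemma ae_eq_ge0_integral (D : set T) (f g : T -> \bar R) :
  (forall x, D x -> (0 <= f x)%E) -> (forall x, D x -> (0 <= g x)%E) ->
  {ae mu, forall x, D x -> f x = g x} ->
  (\int[mu]_(x in D) f x = \int[mu]_(x in D) g x)%E.
Proof.
move=> f0 g0 fg; apply/eqP; rewrite eq_le; apply/andP; split;
  apply: ae_le_ge0_integral => //; by apply: filterS fg => x /[apply] ->.
Qed.

(** Setting the approximating simple functions to zero on the exceptional null
    set makes them converge everywhere. *)
Lemma strongly_measurableP {Y : normedModType R} (D : set T) (f : T -> Y) :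
  measurable D ->
  strongly_measurable mu D f <->
  exists g : T -> Y, [/\ simple_limit g, forall x, ~ D x -> g x = 0 &
    {ae mu, forall x, D x -> f x = g x}].
Proof.
move=> mD; split=> [[s [ss [N [mN N0 Nsf]]]]|[g [[s [ss sg]] _ fg]]]; last first.
  by exists s; split=> //; apply: filterS fg => x /[apply] ->.
exists (patch (fun=> 0) (D `\` N) f); split=> [|x nDx|].
- exists (fun n => patch (fun=> 0) (D `\` N) (s n)); split=> [n|x].
    by apply: simple_patch; [exact: measurableD|exact: ss|exact: simple_cst].
  rewrite /patch; case: ifPn => [|_]; last exact: cvg_cst.
  rewrite inE => -[Dx Nx]; apply: contrapT => sf; apply/Nx/Nsf => /=.
  by apply: contra_not sf; exact.
- by rewrite /patch memNset// => -[].
- exists N; split=> // x; apply: contra_notP => Nx /= Dx.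
  by rewrite /patch mem_set.
Qed.

End ae_integral.

(** * The Bochner integral over a set of finite measure *)

Lemma ge0_cvge0P {R : realType} (u : nat -> \bar R) :
  (forall n, (0 <= u n)%E) ->
  u n @[n --> \oo] --> 0%E <->
  forall e : R, 0 < e -> \forall n \near \oo, (u n < e%:E)%E.
Proof.
move=> u0; split=> [cu e e0|ue].
  have h : nbhs 0%E [set y : \bar R | (y < e%:E)%E].
    by apply: open_nbhs_nbhs; split; [exact: open_ereal_lt_ereal|rewrite /= lte_fin].
  exact: cu h.
apply/fine_cvgP; split.
  by apply: filterS (ue 1 ltr01) => n un; rewrite ge0_fin_numE// (lt_trans un)// ltry.
apply/cvgrPdist_lt => e e0; apply: filterS (ue e e0) => n un.
rewrite sub0r normrN ger0_norm ?fine_ge0//.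
by rewrite -lte_fin fineK// ge0_fin_numE// (lt_trans un)// ltry.
Qed.

Lemma linear_bound {R : realType} {Y Z : normedModType R}
    (L : {linear Y -> Z}) : continuous L ->
  exists2 M : R, 0 < M & forall y, `|L y| <= M * `|y|.
Proof.
move=> /linear_bounded_continuous/linear_boundedP cL.
have /pinfty_ex_gt0[M M0 [_ LM]] :
    \forall r \near +oo, 0 < r /\ forall y, `|L y| <= r * `|y|.
  by apply: filterS2 (nbhs_pinfty_gt (num_real 0)) cL => r.
by exists M.
Qed.

Section simple_integral.
Context {d : measure_display} {T : measurableType d} {R : realType}.
Variables (mu : {measure set T -> \bar R}) (D : set T).
Hypotheses (mD : measurable D) (muD : (mu D < +oo)%E).
Implicit Types Y Z W : normedModType R.

Let fin_level (A : set T) : measurable A -> mu (D `&` A) \is a fin_num.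
Proof.
move=> mA; rewrite ge0_fin_numE//; apply: le_lt_trans muD.
by apply: le_measure; rewrite ?inE//; exact: measurableI.
Qed.

Lemma simple_integral_seq Y (s : T -> Y) (r : seq Y) :
  uniq r -> (forall x, s x \in r) ->
  simple_integral mu D s = \sum_(y <- r) fine (mu (D `&` s @^-1` [set y])) *: y.
Proof.
move=> ur sr; rewrite /simple_integral [RHS]fsbig_seq//; apply: fsbig_widen.
  by move=> _ [x _ <-] /=.
move=> y [/= _ sy]; rewrite (_ : s @^-1` [set y] = set0).
  by rewrite setI0 measure0 scale0r.
by rewrite -subset0 => x /= sxy; apply: sy; exists x.
Qed.

Lemma simple_range Y (s : T -> Y) : simple_function s ->
  exists2 r : seq Y, uniq r & forall x, s x \in r.
Proof.
move=> [/finite_seqP[r rE] _]; exists (undup r); first exact: undup_uniq.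
move=> x; rewrite mem_undup.
have : range s (s x) by exists x.
by rewrite rE.
Qed.

(** Grouping the levels of [w] by the value of [g]; taking for [w] a pair of
    simple functions gives the additivity of the integral. *)
Lemma simple_integral_comp W Y (w : T -> W) (g : W -> Y) (r : seq W) :
  simple_function w -> uniq r -> (forall x, w x \in r) ->
  simple_integral mu D (g \o w) =
  \sum_(z <- r) fine (mu (D `&` w @^-1` [set z])) *: g z.
Proof.
move=> sw ur wr.
rewrite (@simple_integral_seq _ _ (undup (map g r))) ?undup_uniq//; last first.
  by move=> x; rewrite mem_undup; exact: map_f (wr x).
transitivity (\sum_(y <- undup (map g r)) \sum_(z <- r | g z == y)
    fine (mu (D `&` w @^-1` [set z])) *: g z).
  apply: eq_bigr => y _.
  rewrite (_ : D `&` _ = \bigcup_(z in [set` [seq z <- r | g z == y]])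
      (D `&` w @^-1` [set z])); last first.
    apply/seteqP; split=> [x [Dx /= gw]|x [z /=]].
      by exists (w x) => //=; rewrite mem_filter gw eqxx wr.
    by rewrite mem_filter => /andP[/eqP <- _] [Dx /= ->].
  rewrite measure_fin_bigcup; last 3 first.
  - exact: finite_seq.
  - by move=> z z' _ _ [x [[_ /= ->] [_ /= ->]]].
  - by move=> z _; apply: measurableI => //; exact: simple_preimage.
  rewrite -fsbig_seq ?filter_uniq// -sum_fine; last first.
    by move=> z _; apply: fin_level; exact: simple_preimage.
  rewrite scaler_suml big_filter; apply: eq_bigr => z /eqP <-.
  by [].
rewrite (exchange_big_dep xpredT)//=; apply: eq_big_seq => z zr.
under eq_bigl do rewrite eq_sym.
by rewrite -big_filter filter_pred1_uniq ?undup_uniq ?mem_undup ?map_f// big_seq1.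
Qed.

Lemma simple_integralD Y (s s' : T -> Y) :
  simple_function s -> simple_function s' ->
  simple_integral mu D (fun x => s x + s' x) =
  simple_integral mu D s + simple_integral mu D s'.
Proof.
move=> ss ss'; pose w x := (s x, s' x).
have sw : simple_function w by exact: (simple_comp2 pair ss ss').
have [r ur wr] := simple_range sw.
rewrite (simple_integral_comp (fun z => z.1 + z.2) sw ur wr).
rewrite (simple_integral_comp fst sw ur wr) (simple_integral_comp snd sw ur wr).
by rewrite -big_split; apply: eq_bigr => z _; rewrite scalerDr.
Qed.

Lemma simple_integral_linear Y Z (L : {linear Y -> Z}) (s : T -> Y) :
  simple_function s ->
  simple_integral mu D (L \o s) = L (simple_integral mu D s).
Proof.
move=> ss; have [r ur sr] := simple_range ss.
rewrite (simple_integral_comp L ss ur sr) (simple_integral_seq ur sr).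
by rewrite linear_sum; apply: eq_bigr => z _; rewrite linearZ.
Qed.

Lemma simple_integralB Y (s s' : T -> Y) :
  simple_function s -> simple_function s' ->
  simple_integral mu D (fun x => s x - s' x) =
  simple_integral mu D s - simple_integral mu D s'.
Proof.
move=> ss ss'; rewrite simple_integralD//; last exact: (simple_comp -%R).
by rewrite (@simple_integral_linear _ _ -%R).
Qed.

Lemma simple_integral_norm Y (s : T -> Y) : simple_function s ->
  (`|simple_integral mu D s|%:E <= \int[mu]_(x in D) `|s x|%:E)%E.
Proof.
move=> ss; have [r ur sr] := simple_range ss.
have fE x : `|s x|%:E =
    (\sum_(y <- r) (`|y|%:E * (\1_(s @^-1` [set y]) x)%:E))%E.
  rewrite (bigD1_seq (s x))//= big1_seq ?adde0.
    by rewrite indicE mem_set// mule1.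
  by move=> y /andP[/eqP ysx _]; rewrite indicE memNset ?mule0//= => /esym.
under eq_integral do rewrite fE.
have mlev y : measurable (s @^-1` [set y]) by exact: simple_preimage.
rewrite ge0_integral_sum//; last first.
  by move=> y; apply/measurable_EFinP; apply: measurable_funM => //;
    exact: measurable_funTS.
rewrite (simple_integral_seq ur sr).
apply: (@le_trans _ _ (\sum_(y <- r) (fine (mu (D `&` s @^-1` [set y])) *
    `|y|)%:E)%E).
  rewrite sumEFin lee_fin; apply: (le_trans (ler_norm_sum _ _ _)).
  by apply: ler_sum => y _; rewrite normrZ ger0_norm// fine_ge0.
apply: lee_sum => y _; rewrite ge0_integralZl_EFin//; last first.
  by apply/measurable_EFinP; exact: measurable_funTS.
rewrite integral_indic// EFinM fineK ?fin_level//.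
by rewrite setIC muleC.
Qed.

End simple_integral.

Section Bochner_integral.
Context {d : measure_display} {T : measurableType d} {R : realType}.
Variables (mu : {measure set T -> \bar R}) (D : set T).
Hypotheses (mD : measurable D) (muD : (mu D < +oo)%E).

Lemma simple_limit_measurable_normE {Y : normedModType R} (f : T -> Y) :
  simple_limit f -> measurable_fun D (fun x => `|f x|%:E).
Proof.
move=> sf; apply/measurable_EFinP; apply: measurable_funTS.
exact: simple_limit_measurable_norm.
Qed.

(** Values larger than [2 * `|f x|] are cut off. Where [f] vanishes nothing is
    left, and elsewhere the cut-off is eventually inactive. *)
Lemma simple_limit_dominated {Y : normedModType R} (f : T -> Y) :
  simple_limit f -> exists s : nat -> T -> Y,
    [/\ forall n, simple_function (s n),
        forall x, s n x @[n --> \oo] --> f x &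
        forall n x, `|s n x| <= 2 * `|f x|].
Proof.
move=> sf; have [s [ss cs]] := sf.
pose E n := [set x | `|s n x| <= 2 * `|f x|].
have mE n : measurable (E n).
  have : measurable ([set: T] `&`
      (fun x => `|s n x| <= 2 * `|f x|) @^-1` [set true]).
    apply: measurable_fun_ler => //.
      exact/simple_measurable_fun/simple_comp.
    by apply: measurable_funM => //; exact: simple_limit_measurable_norm.
  by rewrite setTI.
exists (fun n => patch (fun=> 0) (E n) (s n)); split.
- by move=> n; apply: simple_patch => //; exact: simple_cst.
- move=> x; have [fx0|fx0] := eqVneq (f x) 0.
    apply: (@cvg_trans _ (0 @[_ --> \oo])); last by rewrite fx0; exact: cvg_cst.
    apply: near_eq_cvg; apply: nearW => n; rewrite /patch; case: ifPn => //.
    rewrite inE /E /= fx0 normr0 mulr0 => snx; apply/eqP.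
    by rewrite eq_sym -normr_eq0 eq_le snx normr_ge0.
  apply: (@cvg_trans _ (s n x @[n --> \oo])); last exact: cs.
  apply: near_eq_cvg.
  have fx : 0 < `|f x| by rewrite normr_gt0.
  apply: filterS ((cvgrPdist_lt _ _).1 (cs x) _ fx) => n /= sfx.
  rewrite /patch ifT// inE /E /=.
  by rewrite -[s n x](subKr (f x)) (le_trans (ler_normB _ _))// mulr_natl mulr2n
    lerD2l ltW.
- move=> n x; rewrite /patch; case: ifPn; first by rewrite inE.
  by rewrite normr0 mulr_ge0.
Qed.

Definition Bochner_integrable {Y : normedModType R} (f : T -> Y) : Prop :=
  simple_limit f /\ (\int[mu]_(x in D) `|f x|%:E < +oo)%E.

Lemma Bochner_approx {Y : normedModType R} (f : T -> Y) :
  Bochner_integrable f -> exists s : nat -> T -> Y,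
    [/\ forall n, simple_function (s n),
        forall x, s n x @[n --> \oo] --> f x &
        (\int[mu]_(x in D) `|f x - s n x|%:E)%E @[n --> \oo] --> 0%E].
Proof.
move=> [sf fi]; have [s [ss cs sle]] := simple_limit_dominated sf.
exists s; split=> //.
have mfs n : measurable_fun D (fun x => `|f x - s n x|%:E).
  apply: simple_limit_measurable_normE; apply: simple_limitB => //.
  exact: simple_simple_limit.
have := @dominated_convergence _ _ _ mu D mD (fun n x => `|f x - s n x|%:E)
  (cst 0%E) (fun x => 3%:E * `|f x|%:E)%E mfs.
case=> //.
- apply: aeW => x _; apply: cvg_EFin; first by apply: nearW.
  rewrite /comp /= -[X in _ --> X](normr0 Y) -(subrr (f x)).
  by apply: cvg_norm; apply: cvgB => //; exact: cvg_cst.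
- apply: integrableZl => //; apply/integrableP; split.
    exact: simple_limit_measurable_normE.
  by under eq_integral do rewrite abse_EFin normr_id.
- apply: aeW => x n _; rewrite abse_EFin normr_id -EFinM lee_fin.
  rewrite (le_trans (ler_normB _ _))//.
  by rewrite -[3%:R]/(1 + 2)%:R natrD mulrDl mul1r lerD2l.
by move=> _ _; rewrite integral0.
Qed.

(** Two approximating sequences have integrals with the same limit, and those of
    a single one form a Cauchy sequence: this estimate gives the uniqueness and
    the existence of the Bochner integral. *)
Lemma simple_integral_dist {Y : normedModType R} (f s s' : T -> Y) :
  simple_limit f -> simple_function s -> simple_function s' ->
  (`|simple_integral mu D s - simple_integral mu D s'|%:E <=
   \int[mu]_(x in D) `|f x - s x|%:E + \int[mu]_(x in D) `|f x - s' x|%:E)%E.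
Proof.
move=> sf ss ss'; rewrite -simple_integralB//.
apply: le_trans (simple_integral_norm mD muD _) _.
  exact: (simple_comp2 (fun y z => y - z)).
have mfs r : simple_function r -> measurable_fun D (fun x => `|f x - r x|%:E).
  move=> sr; apply: simple_limit_measurable_normE; apply: simple_limitB => //.
  exact: simple_simple_limit.
rewrite -ge0_integralD//; [|exact: mfs|exact: mfs].
apply: ge0_le_integral => //.
- apply: simple_limit_measurable_normE; apply: simple_limitB;
    exact: simple_simple_limit.
- by apply: emeasurable_funD; exact: mfs.
move=> x _; rewrite -EFinD lee_fin -[_ - _](subrK (f x)).
rewrite -addrA (distrC (f x)) (le_trans _ (ler_normD _ _))//.
by rewrite addrACA (addrC (- s' x)) addrA.
Qed.

Lemma integrable_simple_finite {Y : normedModType R} (s : T -> Y) :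
  simple_function s -> integrable_simple mu D s.
Proof.
move=> ss; split=> // y _; apply: le_lt_trans muD.
apply: le_measure; rewrite ?inE//; apply: measurableI => //.
exact: simple_preimage.
Qed.

Lemma ae_eq_Bochner_integral {Y : normedModType R} (f g : T -> Y) :
  {ae mu, forall x, D x -> f x = g x} ->
  Bochner_integral mu D f = Bochner_integral mu D g.
Proof.
suff H (f1 f2 : T -> Y) (I : Y) : {ae mu, forall x, D x -> f1 x = f2 x} ->
    has_Bochner_integral mu D f1 I -> has_Bochner_integral mu D f2 I.
  move=> fg; rewrite /Bochner_integral; congr (xget _ _).
  apply/seteqP; split=> I; apply: H => //.
  by apply: filterS fg => x /[apply].
move=> f12 [s [si sf1 fs sI]]; exists s; split=> //.
  by apply: filterS2 f12 sf1 => x fx s1 Dx; rewrite -fx//; exact: s1.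
apply: cvg_trans fs; apply: near_eq_cvg; apply: nearW => n.
apply: ae_eq_ge0_integral => //.
by apply: filterS f12 => x /[apply] ->.
Qed.

Section complete.
Context {Y : completeNormedModType R}.
Implicit Types f g : T -> Y.

(** Every approximating sequence computes the integral, so that its algebraic
    rules follow from a suitable choice of sequences. *)
Lemma Bochner_integral_cvg f (s : nat -> T -> Y) : Bochner_integrable f ->
  (forall n, simple_function (s n)) ->
  (\int[mu]_(x in D) `|f x - s n x|%:E)%E @[n --> \oo] --> 0%E ->
  simple_integral mu D (s n) @[n --> \oo] --> Bochner_integral mu D f.
Proof.
move=> fi; have sf := fi.1.
have dist (s1 s2 : nat -> T -> Y) : (forall n, simple_function (s1 n)) ->
    (forall n, simple_function (s2 n)) ->
    (\int[mu]_(x in D) `|f x - s1 n x|%:E)%E @[n --> \oo] --> 0%E ->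
    (\int[mu]_(x in D) `|f x - s2 n x|%:E)%E @[n --> \oo] --> 0%E ->
    forall e, 0 < e -> exists N, forall m n, (N <= m)%N -> (N <= n)%N ->
      `|simple_integral mu D (s1 m) - simple_integral mu D (s2 n)| < e.
  move=> ss1 ss2 fs1 fs2 e e0.
  have e2 : 0 < e / 2 by rewrite divr_gt0.
  have int0 (r : nat -> T -> Y) n :
    (0 <= \int[mu]_(x in D) `|f x - r n x|%:E)%E by apply: integral_ge0.
  have [N1 _ H1] := (ge0_cvge0P (int0 s1)).1 fs1 _ e2.
  have [N2 _ H2] := (ge0_cvge0P (int0 s2)).1 fs2 _ e2.
  exists (maxn N1 N2) => m n; rewrite !geq_max => /andP[Nm _] /andP[_ Nn].
  rewrite -lte_fin; apply: le_lt_trans (simple_integral_dist sf (ss1 m) (ss2 n)) _.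
  by rewrite (splitr e) EFinD; apply: lteD; [exact: H1|exact: H2].
have same_lim (s1 s2 : nat -> T -> Y) (I : Y) : (forall n, simple_function (s1 n)) ->
    (forall n, simple_function (s2 n)) ->
    (\int[mu]_(x in D) `|f x - s1 n x|%:E)%E @[n --> \oo] --> 0%E ->
    (\int[mu]_(x in D) `|f x - s2 n x|%:E)%E @[n --> \oo] --> 0%E ->
    simple_integral mu D (s1 n) @[n --> \oo] --> I ->
    simple_integral mu D (s2 n) @[n --> \oo] --> I.
  move=> ss1 ss2 fs1 fs2 sI.
  rewrite -[X in _ --> X](subr0 I).
  apply: (@cvg_trans _ ((simple_integral mu D (s1 n) -
    (simple_integral mu D (s1 n) - simple_integral mu D (s2 n))) @[n --> \oo])).
    by apply: near_eq_cvg; apply: nearW => n; rewrite subKr.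
  apply: cvgB => //; apply/cvgrPdist_lt => e /(dist _ _ ss1 ss2 fs1 fs2)[N HN].
  by exists N => // n /= Nn; rewrite sub0r normrN HN.
have [r [sr cr fr]] := Bochner_approx fi.
have rI : has_Bochner_integral mu D f (lim (simple_integral mu D (r n) @[n --> \oo])).
  exists r; split=> //.
  - by move=> n; exact: integrable_simple_finite.
  - by apply: aeW => x _.
  apply/cauchy_cvgP/cauchy_exP => e /(dist _ _ sr sr fr fr)[N HN].
  exists (simple_integral mu D (r N)); exists N => // n /= Nn.
  by rewrite -ball_normE /=; exact: HN.
move=> ss fs.
rewrite /Bochner_integral; case: xgetP => [I _ [r' [sr' _ fr' r'I]]|/(_ _ rI)//].
by apply: same_lim r'I => // n; case: (sr' n).
Qed.

Lemma Bochner_integral_unique f (s : nat -> T -> Y) I : Bochner_integrable f ->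
  (forall n, simple_function (s n)) ->
  (\int[mu]_(x in D) `|f x - s n x|%:E)%E @[n --> \oo] --> 0%E ->
  simple_integral mu D (s n) @[n --> \oo] --> I -> Bochner_integral mu D f = I.
Proof.
move=> fi ss fs sI.
by apply: (cvg_unique _ (Bochner_integral_cvg fi ss fs) sI).
Qed.

End complete.
End Bochner_integral.

Section Bochner_operations.
Context {d : measure_display} {T : measurableType d} {R : realType}.
Variables (mu : {measure set T -> \bar R}).

Lemma Bochner_integrableS {Y : normedModType R} (D E : set T) (f : T -> Y) :
  measurable D -> measurable E -> E `<=` D ->
  Bochner_integrable mu D f -> Bochner_integrable mu E f.
Proof.
move=> mD mE ED [sf fi]; split=> //; apply: le_lt_trans fi.
apply: ge0_subset_integral => //.
exact: simple_limit_measurable_normE.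
Qed.

Lemma Bochner_integral_null {Y : completeNormedModType R} (D : set T)
    (f : T -> Y) : measurable D -> mu D = 0 -> simple_limit f ->
  Bochner_integral mu D f = 0.
Proof.
move=> mD D0 sf.
rewrite (@ae_eq_Bochner_integral _ _ _ _ _ _ _ (fun=> 0)); last first.
  by exists D; split=> // x /= /not_implyP[].
have s0 : simple_function (fun _ : T => 0 : Y) by exact: simple_cst.
apply: (@Bochner_integral_unique _ _ _ mu D _ _ _ _ (fun _ _ => 0)) => //.
- by rewrite D0.
- split; first exact: simple_simple_limit.
  by under eq_integral do rewrite normr0; rewrite integral0.
- under eq_fun do under eq_integral do rewrite subrr normr0.
  by under eq_fun do rewrite integral0; exact: cvg_cst.
- have : @simple_integral _ _ _ Y mu D (fun=> 0) = 0.
    have := @simple_integral_linear _ _ _ mu D mD _ _ _ \0 _ s0.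
    by apply; rewrite D0.
  by move=> ->; exact: cvg_cst.
Qed.

Section fixed_domain.
Variable D : set T.
Hypotheses (mD : measurable D) (muD : (mu D < +oo)%E).
Context {Y : completeNormedModType R}.
Implicit Types f g : T -> Y.

Let measurable_dist f s : simple_limit f -> simple_function s ->
  measurable_fun D (fun x => `|f x - s x|%:E).
Proof.
move=> sf ss; apply: simple_limit_measurable_normE; apply: simple_limitB => //.
exact: simple_simple_limit.
Qed.

Lemma Bochner_integrableD f g : Bochner_integrable mu D f ->
  Bochner_integrable mu D g -> Bochner_integrable mu D (fun x => f x + g x).
Proof.
move=> [sf fi] [sg gi]; split; first exact: simple_limitD.
apply: (@le_lt_trans _ _
    (\int[mu]_(x in D) (`|f x|%:E + `|g x|%:E))%E).
  apply: ae_le_ge0_integral => // [x _|]; [by rewrite adde_ge0|apply: aeW => x _].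
  by rewrite -EFinD lee_fin ler_normD.
rewrite ge0_integralD//; [exact: lte_add_pinfty|
  exact: simple_limit_measurable_normE|exact: simple_limit_measurable_normE].
Qed.

Lemma Bochner_integralD f g : Bochner_integrable mu D f ->
  Bochner_integrable mu D g ->
  Bochner_integral mu D (fun x => f x + g x) =
  Bochner_integral mu D f + Bochner_integral mu D g.
Proof.
move=> fi gi; have fgi := Bochner_integrableD fi gi.
have [s [ss cs fs]] := Bochner_approx mD fi.
have [s' [ss' cs' gs]] := Bochner_approx mD gi.
apply: (@Bochner_integral_unique _ _ _ mu D mD muD _ _ (fun n x => s n x + s' n x)) => //.
- by move=> n; apply: (simple_comp2 +%R).
- have := cvgeD _ fs gs; rewrite adde0 => /(_ _ isT) h.
  apply: squeeze_cvge (cvg_cst 0%E) h; apply: nearW => n.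
  rewrite integral_ge0//= -ge0_integralD//; last 2 first.
  - exact: measurable_dist fi.1 (ss n).
  - exact: measurable_dist gi.1 (ss' n).
  apply: ae_le_ge0_integral => // [x _|]; [by rewrite adde_ge0|apply: aeW => x _].
  by rewrite -EFinD lee_fin opprD addrACA ler_normD.
- under eq_fun do rewrite simple_integralD//.
  by apply: cvgD; apply: Bochner_integral_cvg.
Qed.

Lemma Bochner_integrable_linear {Z : normedModType R} (L : {linear Y -> Z}) f :
  continuous L -> Bochner_integrable mu D f -> Bochner_integrable mu D (L \o f).
Proof.
move=> cL [sf fi]; have [M M0 LM] := linear_bound cL.
split; first exact: simple_limit_comp.
apply: (@le_lt_trans _ _ (\int[mu]_(x in D) (M%:E * `|f x|%:E))%E).
  apply: ae_le_ge0_integral => // [x _|]; last by apply: aeW => x _; exact: LM.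
  by rewrite -EFinM lee_fin mulr_ge0// ltW.
rewrite ge0_integralZl_EFin ?(ltW M0)//; last exact: simple_limit_measurable_normE.
by rewrite lte_mul_pinfty// lee_fin ltW.
Qed.

Lemma Bochner_integral_linear {Z : completeNormedModType R}
    (L : {linear Y -> Z}) f : continuous L -> Bochner_integrable mu D f ->
  Bochner_integral mu D (L \o f) = L (Bochner_integral mu D f).
Proof.
move=> cL fi; have Lfi := Bochner_integrable_linear cL fi.
have [M M0 LM] := linear_bound cL.
have [s [ss cs fs]] := Bochner_approx mD fi.
apply: (@Bochner_integral_unique _ _ _ mu D mD muD _ _ (fun n => L \o s n)) => //.
- by move=> n; exact: simple_comp.
- have h := cvgeZl (erefl : M%:E \is a fin_num) fs; rewrite mule0 in h.
  apply: squeeze_cvge (cvg_cst 0%E) h; apply: nearW => n.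
  rewrite integral_ge0//= -ge0_integralZl_EFin ?(ltW M0)//; last first.
    exact: measurable_dist fi.1 (ss n).
  apply: ae_le_ge0_integral => // [x _|]; first by rewrite -EFinM lee_fin mulr_ge0// ltW.
  by apply: aeW => x _; rewrite -EFinM lee_fin/= -linearB.
- under eq_fun do rewrite simple_integral_linear//.
  apply: (continuous_cvg _ (cL _)); exact: Bochner_integral_cvg.
Qed.

Lemma Bochner_integral_norm f : Bochner_integrable mu D f ->
  (`|Bochner_integral mu D f|%:E <= \int[mu]_(x in D) `|f x|%:E)%E.
Proof.
move=> fi; have [s [ss cs fs]] := Bochner_approx mD fi.
have cI : `|simple_integral mu D (s n)|%:E @[n --> \oo] -->
    `|Bochner_integral mu D f|%:E.
  by apply: cvg_EFin; [exact: nearW|exact: cvg_norm (Bochner_integral_cvg mD muD fi ss fs)].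
have h : (\int[mu]_(x in D) `|f x|%:E + \int[mu]_(x in D) `|f x - s n x|%:E)%E
    @[n --> \oo] --> (\int[mu]_(x in D) `|f x|%:E + 0)%E.
  by apply: cvgeD => //; [rewrite adde_defC fin_num_adde_defr|exact: cvg_cst].
rewrite adde0 in h; apply: lee_cvg_to cI h _; apply: nearW => n.
apply: le_trans (simple_integral_norm mD muD (ss n)) _.
rewrite -ge0_integralD//; last 2 first.
- exact: simple_limit_measurable_normE fi.1.
- exact: measurable_dist fi.1 (ss n).
apply: ae_le_ge0_integral => // [x _|]; [by rewrite adde_ge0|apply: aeW => x _].
by rewrite -EFinD lee_fin -[in leLHS](subKr (f x) (s n x)) ler_normB.
Qed.

End fixed_domain.

Lemma Bochner_integral_setU {Y : completeNormedModType R} (A B : set T)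
    (f : T -> Y) : measurable A -> measurable B -> [disjoint A & B] ->
  (mu A < +oo)%E -> (mu B < +oo)%E -> Bochner_integrable mu (A `|` B) f ->
  Bochner_integral mu (A `|` B) f =
  Bochner_integral mu A f + Bochner_integral mu B f.
Proof.
move=> mA mB AB muA muB fi.
have mAB : measurable (A `|` B) by exact: measurableU.
have muAB : (mu (A `|` B) < +oo)%E.
  by rewrite (le_lt_trans (measureU2 mu mA mB))// lte_add_pinfty.
have [s [ss cs fs]] := Bochner_approx mAB fi.
have sub (C : set T) : measurable C -> C `<=` A `|` B ->
    (\int[mu]_(x in C) `|f x - s n x|%:E)%E @[n --> \oo] --> 0%E.
  move=> mC CAB; apply: squeeze_cvge (cvg_cst 0%E) fs; apply: nearW => n.
  rewrite integral_ge0//=; apply: ge0_subset_integral => //.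
  apply: simple_limit_measurable_normE; apply: simple_limitB; first exact: fi.1.
  exact: simple_simple_limit.
have cvg (C : set T) : measurable C -> (mu C < +oo)%E -> C `<=` A `|` B ->
    simple_integral mu C (s n) @[n --> \oo] --> Bochner_integral mu C f.
  move=> mC muC CAB; apply: Bochner_integral_cvg => //; last exact: sub.
  exact: Bochner_integrableS fi.
apply: (@Bochner_integral_unique _ _ _ mu _ mAB muAB _ f s) => //.
apply: cvg_trans (cvgD (cvg A mA muA _) (cvg B mB muB _)) => //.
apply: near_eq_cvg; apply: nearW => n.
have [r ur sr] := simple_range (ss n).
change (simple_integral mu A (s n) + simple_integral mu B (s n) =
  simple_integral mu (A `|` B) (s n)).
rewrite !(simple_integral_seq _ _ ur sr) -big_split/=; apply: eq_bigr => y _.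
have my : measurable (s n @^-1` [set y]) by exact: simple_preimage.
have finI (C : set T) : measurable C -> (mu C < +oo)%E ->
    mu (C `&` s n @^-1` [set y]) \is a fin_num.
  move=> mC muC; rewrite ge0_fin_numE//; apply: le_lt_trans muC.
  by apply: le_measure; rewrite ?inE//; exact: measurableI.
rewrite -scalerDl setIUl measureU//; last 3 first.
- exact: measurableI.
- exact: measurableI.
- by rewrite setIACA (disj_set2P AB) set0I.
by rewrite fineD// finI.
Qed.

End Bochner_operations.

(** * Translations of the line *)

Section translation.
Context {R : realType}.
Local Notation mu := (@lebesgue_measure R).
Variable c : R.
Let shift (x : R) : measurableTypeR R := x + c.

Let measurable_shift : measurable_fun [set: measurableTypeR R] shift.
Proof. exact: measurable_funD. Qed.

Lemma measurable_translation (A : set (measurableTypeR R)) :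
  measurable A -> measurable ((fun x => x + c) @^-1` A : set (measurableTypeR R)).
Proof. by move=> mA; rewrite -[X in measurable X]setTI; exact: measurable_shift. Qed.

Lemma lebesgue_measure_translation (A : set (measurableTypeR R)) :
  measurable A -> mu ((fun x => x + c) @^-1` A) = mu A.
Proof.
move=> mA.
rewrite (_ : mu A = pushforward mu shift A)//; apply: lebesgue_measure_unique => //.
move=> _ [[a b]] _ <-.
transitivity (mu [set` `]a - c, b - c]%R]).
  rewrite !lebesgue_measure_itv/= !lte_fin ltrD2r; case: ifP => // _.
  by rewrite -!EFinD; congr EFin; rewrite opprB addrA subrK.
congr (mu _); apply/seteqP.
by split=> x /=; rewrite /shift !in_itv/= ltrBlDr lerBrDr.
Qed.

Lemma ge0_integral_translation (D : set (measurableTypeR R))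
    (h : measurableTypeR R -> \bar R) :
  measurable D -> measurable_fun D h -> (forall x, D x -> (0 <= h x)%E) ->
  (\int[mu]_(x in (fun x : R => (x + c)%R) @^-1` D) h (x + c)%R =
   \int[mu]_(x in D) h x)%E.
Proof.
move=> mD mh h0; rewrite -(ge0_integral_pushforward measurable_shift mu mD mh)//.
  by apply: eq_measure_integral => A mA _; exact: lebesgue_measure_translation.
by move=> x; rewrite inE; exact: h0.
Qed.

Lemma ae_translation (P : R -> Prop) :
  {ae mu, forall x, P x} -> {ae mu, forall x, P (x + c)}.
Proof.
move=> [N [mN N0 NP]]; exists ((fun x => x + c) @^-1` N); split.
- exact: measurable_translation.
- by rewrite -N0; exact: lebesgue_measure_translation.
- by move=> x /= Px; exact: NP.
Qed.

Section vector_valued.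
Context {Y : normedModType R}.
Implicit Types f s : measurableTypeR R -> Y.

Lemma simple_translation s :
  simple_function s -> simple_function (fun x : measurableTypeR R => s (x + c)).
Proof.
move=> [fs ms]; split=> [|y].
  by apply: sub_finite_set fs => _ [x _ <-]; exists (x + c).
exact: (measurable_translation (ms y)).
Qed.

Lemma simple_limit_translation f :
  simple_limit f -> simple_limit (fun x : measurableTypeR R => f (x + c)).
Proof.
move=> [s [ss sf]]; exists (fun n x => s n (x + c)); split=> [n|x] //.
exact: simple_translation.
Qed.

Lemma simple_integral_translation (D : set (measurableTypeR R)) s :
  measurable D -> simple_function s ->
  simple_integral mu ((fun x => x + c) @^-1` D) (fun x => s (x + c)) =
  simple_integral mu D s.
Proof.
move=> mD ss; have [r ur sr] := simple_range ss.
have sr' (x : measurableTypeR R) : s (x + c) \in r by exact: sr.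
rewrite (simple_integral_seq _ _ ur sr) (simple_integral_seq _ _ ur sr').
apply: eq_bigr => y _; congr (fine _ *: _).
apply: lebesgue_measure_translation (D `&` s @^-1` [set y]) _.
by apply: measurableI => //; exact: simple_preimage.
Qed.

End vector_valued.

Lemma Bochner_integral_translation {Y : completeNormedModType R}
    (D : set (measurableTypeR R)) (f : measurableTypeR R -> Y) :
  measurable D -> (mu D < +oo)%E -> Bochner_integrable mu D f ->
  Bochner_integral mu ((fun x => x + c) @^-1` D) (fun x => f (x + c)) =
  Bochner_integral mu D f.
Proof.
move=> mD muD fi; have [s [ss cs fs]] := Bochner_approx mD fi.
have mD' := measurable_translation mD.
have intE (g : measurableTypeR R -> Y) : simple_limit g ->
    (\int[mu]_(x in (fun x : R => (x + c)%R) @^-1` D) `|g (x + c)%R|%:E =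
     \int[mu]_(x in D) `|g x|%:E)%E.
  move=> sg; apply: (ge0_integral_translation (h := fun x => `|g x|%:E)) => //.
  exact: simple_limit_measurable_normE.
apply: (@Bochner_integral_unique _ _ _ mu _ mD' _ _ _ (fun n x => s n (x + c))).
- exact: (eq_ind_r (fun z => (z < +oo)%E) muD (lebesgue_measure_translation mD)).
- split; first exact/simple_limit_translation/fi.1.
  by rewrite intE//; [exact: fi.2|exact: fi.1].
- by move=> n; exact: simple_translation.
- apply: cvg_trans fs; apply: near_eq_cvg; apply: nearW => n.
  rewrite (intE (fun x => f x - s n x))//; apply: simple_limitB; first exact: fi.1.
  exact: simple_simple_limit.
- under eq_fun do rewrite simple_integral_translation//.
  exact: Bochner_integral_cvg.
Qed.

End translation.

(** * The L^p norm of vector-valued functions *)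

Lemma cvg_powR {R : realType} (u : nat -> R) (l r : R) :
  1 <= r -> (forall n, 0 <= u n) -> u n @[n --> \oo] --> l ->
  u n `^ r @[n --> \oo] --> l `^ r.
Proof.
move=> r1 u0 ul; have r0 : 0 < r by rewrite (lt_le_trans _ r1).
have : 0 <= l by apply: (cvgr_to_ge ul); exact: nearW.
rewrite le_eqVlt => /predU1P[l0|l0].
  move: ul; rewrite -l0 powR0 ?gt_eqF// => ul.
  apply: (squeeze_cvgr _ (cvg_cst 0) ul).
  apply: filterS ((cvgrPdist_lt _ _).1 ul 1 ltr01) => n.
  rewrite sub0r normrN ger0_norm// => un1; rewrite powR_ge0/=.
  have [->|un0] := eqVneq (u n) 0; first by rewrite powR0 ?gt_eqF.
  by rewrite ge1r_powR// lt_neqAle eq_sym un0 u0 ltW.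
apply: (@cvg_trans _ (expR (r * ln (u n)) @[n --> \oo])).
  apply: near_eq_cvg; apply: filterS (cvgr_gt _ ul _ l0) => n un.
  by rewrite /powR gt_eqF.
rewrite /powR (gt_eqF l0); apply: continuous_cvg; first exact: continuous_expR.
by apply: cvgM; [exact: cvg_cst|]; apply: continuous_cvg => //; exact: continuous_ln.
Qed.

Section Lnorm.
Context {d : measure_display} {T : measurableType d} {R : realType}.
Variables (mu : {measure set T -> \bar R}) (p : \bar R).
Hypothesis p1 : (1 <= p)%E.
Local Open Scope ereal_scope.

Let pow_le (r : R) (x y : \bar R) :
  (1 <= r)%R -> 0 <= x -> x <= y -> x `^ r <= y `^ r.
Proof.
move=> r1 x0 xy; apply: gt0_ler_poweR => //; first exact: le_trans r1.
  by rewrite in_itv/= x0 leey.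
by rewrite in_itv/= (le_trans x0 xy) leey.
Qed.

Let pow_inv_le (r : R) (x y : \bar R) :
  (1 <= r)%R -> 0 <= x -> x <= y -> x `^ r^-1 <= y `^ r^-1.
Proof.
move=> r1 x0 xy; apply: gt0_ler_poweR => //.
- by rewrite invr_ge0 (le_trans _ r1).
- by rewrite in_itv/= x0 leey.
by rewrite in_itv/= (le_trans x0 xy) leey.
Qed.

Lemma ae_le_Lnorm (f g : T -> \bar R) :
  {ae mu, forall x, `|f x| <= `|g x|} -> 'N[mu]_p[f] <= 'N[mu]_p[g].
Proof.
move=> fg; rewrite unlock; case: p p1 => [r||]//=; rewrite ?lee_fin => r1.
  apply: pow_inv_le => //.
    by apply: integral_ge0 => x _; exact: poweR_ge0.
  apply: ae_le_ge0_integral => [x _|x _|]; [exact: poweR_ge0..|].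
  by apply: filterS fg => x fgx _; exact: pow_le.
by case: ifPn => // _; exact: le_ess_sup.
Qed.

Lemma ae_eq_Lnorm (f g : T -> \bar R) :
  {ae mu, forall x, `|f x| = `|g x|} -> 'N[mu]_p[f] = 'N[mu]_p[g].
Proof.
move=> fg; apply/eqP; rewrite eq_le !ae_le_Lnorm//;
  by apply: filterS fg => x ->.
Qed.

Lemma Lnorm_le_poweR (r : R) (f : T -> \bar R) (c : R) : (1 <= r)%R ->
  (0 <= c)%R ->
  'N[mu]_r%:E[f] <= c%:E <-> \int[mu]_x (`|f x| `^ r) <= c%:E `^ r.
Proof.
move=> r1 c0; have r0 : r != 0%R by rewrite gt_eqF// (lt_le_trans _ r1).
rewrite -poweR_Lnorm//; split=> h.
  by apply: pow_le => //; exact: Lnorm_ge0.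
have : ('N[mu]_r%:E[f] `^ r) `^ r^-1 <= (c%:E `^ r) `^ r^-1.
  by apply: pow_inv_le => //; exact: poweR_ge0.
by rewrite -!poweRrM mulfV// (poweRe1 (Lnorm_ge0 _ _ _)) poweRe1// lee_fin.
Qed.

Lemma cvg_poweR (u : nat -> R) (l : \bar R) (r : R) : (1 <= r)%R ->
  (forall n, (0 <= u n)%R) -> (u n)%:E @[n --> \oo] --> l ->
  (u n)%:E `^ r @[n --> \oo] --> l `^ r.
Proof.
move=> r1 u0; case: l => [l||] ul.
- rewrite poweR_EFin; apply: cvg_EFin; first exact: nearW.
  by apply: cvg_powR => //; exact: (fine_cvg ul).
- rewrite poweRyr ?gt_eqF ?(lt_le_trans _ r1)//.
  apply/cvgeyPgt => A; apply: filterS (cvgey_gt ul (Num.max 1 A)%R) => n.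
  rewrite !lte_fin gt_max => /andP[un1 uA].
  by rewrite (lt_le_trans uA)// le1r_powR// ltW.
- have : (0 <= -oo :> \bar R) by apply: (cvge_to_ge ul); exact: nearW.
  by [].
Qed.

Lemma Lnorm_fatou (f_ : nat -> T -> R) (g : T -> \bar R) (c : R) : (0 <= c)%R ->
  (forall n, measurable_fun [set: T] (f_ n)) ->
  (forall n x, (0 <= f_ n x)%R) ->
  (forall x, (f_ n x)%:E @[n --> \oo] --> g x) ->
  (forall n, 'N[mu]_p[EFin \o f_ n] <= c%:E) -> 'N[mu]_p[g] <= c%:E.
Proof.
move=> c0 mf f0 fg fc.
have g0 x : 0 <= g x.
  by apply: (cvge_to_ge (fg x)); apply: nearW => n; rewrite lee_fin.
case: p p1 fc => [r||]//; rewrite ?lee_fin => r1 fc.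
  have r0 : r != 0%R by rewrite gt_eqF// (lt_le_trans _ r1).
  apply/Lnorm_le_poweR => //.
  have fc' n : \int[mu]_x ((f_ n x)%:E `^ r) <= c%:E `^ r.
    apply: le_trans ((Lnorm_le_poweR _ r1 c0).1 (fc n)).
    by apply: ae_le_ge0_integral => [x _|x _|]; [exact: poweR_ge0..|
      apply: aeW => x _; rewrite /= ger0_norm].
  have mfp n : measurable_fun [set: T] (fun x => (f_ n x)%:E `^ r).
    by apply: (measurableT_comp (measurable_poweR r)); exact/measurable_EFinP.
  have := fatou mu measurableT mfp (fun n x _ => poweR_ge0 _ _).
  rewrite (eq_integral (fun x => `|g x| `^ r)); last first.
    move=> x _; rewrite gee0_abs//.
    exact: (cvg_limn_einf_sup (cvg_poweR r1 (f0 ^~ x) (fg x))).1.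
  move=> /le_trans; apply; rewrite limn_einf_lim.
  apply: lime_le; first exact: is_cvg_einfs.
  apply: nearW => n; apply: ge_ereal_inf.
  by exists (\int[mu]_x ((f_ n x)%:E `^ r)) => //; exists n => //=.
move: fc; rewrite unlock; case: ifPn => // mu0 fc.
apply/ess_supP; have : {ae mu, forall x, forall n, (f_ n x)%:E <= c%:E}.
  apply: ae_foralln => n; have /ess_supP := fc n.
  by apply: filterS => x /=; rewrite ger0_norm.
apply: filterS => x fcx /=; rewrite gee0_abs//.
by apply: (cvge_to_le (fg x)); exact: nearW.
Qed.

Lemma Lnorm_fin_ae (g : T -> \bar R) : measurable_fun [set: T] g ->
  'N[mu]_p[g] < +oo -> {ae mu, forall x, `|g x| < +oo}.
Proof.
move=> mg; case: p p1 => [r||]//; rewrite ?lee_fin => r1 gy.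
  have r0 : (0 < r)%R by rewrite (lt_le_trans _ r1).
  have : mu.-integrable [set: T] (fun x => `|g x| `^ r).
    apply/integrableP; split.
      by apply: (measurableT_comp (measurable_poweR r)); exact: measurableT_comp.
    under eq_integral do rewrite gee0_abs ?poweR_ge0//.
    by rewrite -poweR_Lnorm ?gt_eqF// poweR_lty.
  move=> /(integrable_ae measurableT); apply: filterS => x /(_ I) gr.
  by rewrite (@lty_poweRy _ _ r) ?gt_eqF// -ge0_fin_numE ?poweR_ge0.
move: gy; rewrite unlock; case: ifPn => [_ gy|].
  by apply: filterS (ess_sup_ge mu (abse \o g)) => x /= /le_lt_trans; apply.
by rewrite -leNgt measure_le0 => /eqP m0 _; exact: measure0_ae.
Qed.

Section vector_valued.
Context {Y : normedModType R}.
Implicit Types v w : T -> Y.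

Definition vLnorm v := Lnorm mu p (fun x => `|v x|%:E).

Lemma vLnorm_ge0 v : 0 <= vLnorm v. Proof. exact: Lnorm_ge0. Qed.

Lemma ae_le_vLnorm v w : {ae mu, forall x, (`|v x| <= `|w x|)%R} ->
  vLnorm v <= vLnorm w.
Proof.
move=> vw; apply: ae_le_Lnorm; apply: filterS vw => x.
by rewrite !abse_EFin !normr_id lee_fin.
Qed.

Lemma vLnormD v w : simple_limit v -> simple_limit w ->
  vLnorm (fun x => v x + w x)%R <= vLnorm v + vLnorm w.
Proof.
move=> sv sw; have mv := simple_limit_measurable_norm sv.
have mw := simple_limit_measurable_norm sw.
apply: le_trans (eminkowski mu mv mw p1); apply: ae_le_Lnorm.
apply: aeW => x; rewrite /= !normr_id lee_fin.
by rewrite (ger0_norm (addr_ge0 _ _))// ler_normD.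
Qed.

Lemma vLnormZ (a : R) v : simple_limit v ->
  vLnorm (fun x => a *: v x)%R = `|a|%:E * vLnorm v.
Proof.
move=> sv; have mv := simple_limit_measurable_norm sv.
rewrite /vLnorm unlock; case: p p1 => [r||]//; rewrite ?lee_fin => r1.
  have r0 : (0 < r)%R by rewrite (lt_le_trans _ r1).
  under eq_integral do rewrite normrZ EFinM abseM poweRM// !abse_EFin normr_id.
  rewrite ge0_integralZl_EFin ?powR_ge0//; last 2 first.
  - by move=> x _; exact: poweR_ge0.
  - apply: (measurableT_comp (measurable_poweR r)); apply/measurable_EFinP.
    exact: measurableT_comp.
  rewrite poweRM ?poweR_ge0 ?integral_ge0//.
    by rewrite -poweR_EFin -poweRrM mulfV ?gt_eqF// poweRe1.
  by move=> x _; exact: poweR_ge0.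
case: ifPn => [mu0|]; last by rewrite mule0.
rewrite -ess_supZl//; congr (ess_sup _ _); apply/funext => x /=.
by rewrite normrZ normrM !normr_id EFinM.
Qed.

Lemma vLnorm_eq0 v : simple_limit v -> vLnorm v = 0 ->
  {ae mu, forall x, v x = 0%R}.
Proof.
move=> sv /Lnorm_eq0_eq0 v0.
have mv : measurable_fun [set: T] (fun x => `|v x|%:E).
  exact/measurable_EFinP/simple_limit_measurable_norm.
apply: filterS (v0 mv (lt_le_trans lte01 p1)) => x /(_ I)[].
by move=> /eqP; rewrite normr_eq0 => /eqP.
Qed.

Lemma vLnorm0 : vLnorm (fun=> 0%R) = 0.
Proof.
rewrite /vLnorm; under eq_fun do rewrite normr0.
by rewrite Lnorm0// gt_eqF// (lt_le_trans lte01 p1).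
Qed.

Lemma vLnorm_sum (v_ : nat -> T -> Y) (c : nat -> R) m n :
  (forall k, simple_limit (v_ k)) -> (forall k, vLnorm (v_ k) <= (c k)%:E) ->
  vLnorm (fun x => \sum_(m <= k < n) v_ k x)%R <= (\sum_(m <= k < n) c k)%:E.
Proof.
move=> sv vc; elim: n => [|n ih].
  by rewrite big_geq//; under eq_fun do rewrite big_geq//; rewrite vLnorm0.
have [mn|nm] := leqP m n; last first.
  by rewrite big_geq//; under eq_fun do rewrite big_geq//; rewrite vLnorm0.
rewrite big_nat_recr//= EFinD; under eq_fun do rewrite big_nat_recr//=.
apply: le_trans (vLnormD _ (sv n)) _; first exact: simple_limit_sum.
exact: leeD.
Qed.

End vector_valued.
End Lnorm.

(** A Riesz--Fischer theorem: the sum of the series of norms has a finite L^p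
    norm by Fatou's lemma, so the series converges almost everywhere, and
    Fatou's lemma again bounds its tails. *)
Lemma vLnorm_series {d : measure_display} {T : measurableType d}
    {R : realType} (mu : {measure set T -> \bar R}) (p : \bar R)
    {Y : completeNormedModType R} (v_ : nat -> T -> Y) (c b : nat -> R) :
  (1 <= p)%E -> (forall k, simple_limit (v_ k)) ->
  (forall k, (vLnorm mu p (v_ k) <= (c k)%:E)%E) ->
  (forall m n, \sum_(m <= k < n) c k <= b m) ->
  exists x : T -> Y, simple_limit x /\ forall n,
    (vLnorm mu p (fun t => x t - \sum_(0 <= k < n) v_ k t)%R <= (b n)%:E)%E.
Proof.
move=> p1 sv vc cb.
have b0 n : 0 <= b n by apply: le_trans (cb n n); rewrite big_geq.
pose f_ n t := \sum_(0 <= k < n) `|v_ k t|.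
pose g t := (\sum_(0 <= k <oo) `|v_ k t|%:E)%E.
have f0 n t : 0 <= f_ n t by exact: sumr_ge0.
have snv k : simple_limit (fun t => `|v_ k t|).
  by apply: (@simple_limit_comp _ _ _ _ _ Num.norm) => //; exact: norm_continuous.
have sf n : simple_limit (f_ n) by exact: simple_limit_sum.
have mf n : measurable_fun [set: T] (f_ n).
  have := simple_limit_measurable_norm (sf n).
  by under eq_fun do rewrite ger0_norm//.
have fg t : (f_ n t)%:E @[n --> \oo] --> g t.
  rewrite /f_; under eq_fun do rewrite -sumEFin.
  by apply: is_cvg_nneseries => k _ _; rewrite lee_fin.
have mg : measurable_fun [set: T] g.
  apply: (emeasurable_fun_cvg (fun n t => (f_ n t)%:E)) => // n.
  exact/measurable_EFinP.
have fN n : ('N[mu]_p[EFin \o f_ n] <= (b 0)%:E)%E.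
  rewrite (@ae_eq_Lnorm _ _ _ mu p p1 _ (fun t => `|f_ n t|%:E)); last first.
    by apply: aeW => t /=; rewrite normr_id.
  apply: (@le_trans _ _ (\sum_(0 <= k < n) c k)%:E); last by rewrite lee_fin.
  apply: (vLnorm_sum p1 _ _ snv) => k; apply: le_trans (vc k).
  by apply: ae_le_Lnorm => //; apply: aeW => t /=; rewrite !normr_id.
have gN := Lnorm_fatou p1 (b0 0) mf f0 fg fN.
have [N [mN N0 NP]] := Lnorm_fin_ae p1 mg (le_lt_trans gN (ltry _)).
pose w_ k := patch (fun=> 0) (~` N) (v_ k).
have wv : {ae mu, forall t, forall k, w_ k t = v_ k t}.
  exists N; split=> // t; apply: contra_notP => Nt k.
  by rewrite /w_ /patch mem_set.
have sw k : simple_limit (w_ k).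
  apply: simple_limit_patch => //; first exact: measurableC.
  exact/simple_simple_limit/simple_cst.
have cw t : cvgn (series (w_ ^~ t)).
  apply: normed_cvg; apply: nnseries_is_cvg => //=.
  have [Nt|Nt] := pselect (N t).
    rewrite eseries0 ?ltry// => k _ _.
    by rewrite /w_ /patch memNset// ?normr0//; exact.
  suff : (g t < +oo)%E by rewrite /g /w_ /patch mem_set.
  apply: contrapT => gt; apply/Nt/NP => /=; apply: contra_not gt.
  by apply: le_lt_trans; exact: lee_abs.
pose x t := limn (series (w_ ^~ t)).
have sx : simple_limit x.
  by apply: simple_limit_cvg cw => n; exact: simple_limit_sum.
exists x; split=> // n.
rewrite /vLnorm (@ae_eq_Lnorm _ _ _ mu p p1 _
    (fun t => `|x t - \sum_(0 <= k < n) w_ k t|%:E)); last first.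
  by apply: filterS wv => t wvt; under eq_bigr do rewrite -wvt.
apply: (Lnorm_fatou p1 (b0 n) (f_ := fun m t => `|\sum_(n <= k < n + m) w_ k t|)).
- by move=> m; apply: simple_limit_measurable_norm; exact: simple_limit_sum.
- by move=> m t.
- move=> t; apply: cvg_EFin; first exact: nearW.
  apply: cvg_norm.
  apply: (@cvg_trans _ ((series (w_ ^~ t) (n + m) - \sum_(0 <= k < n) w_ k t)
      @[m --> \oo])).
    apply: near_eq_cvg; apply: nearW => m.
    by rewrite /series/= (@big_cat_nat _ _ _ n) ?leq_addr//= addrAC subrr add0r.
  apply: cvgB; last exact: cvg_cst.
  by apply: cvg_comp (cw t); rewrite /=; exact: cvg_addnl.
move=> m; apply: (@le_trans _ _ (\sum_(n <= k < n + m) c k)%:E); last first.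
  by rewrite lee_fin.
rewrite (@ae_eq_Lnorm _ _ _ mu p p1 _
  (fun t => `|\sum_(n <= k < n + m) w_ k t|%:E)) ?/=; last by exact: aeW.
apply: (vLnorm_sum p1 _ _ sw) => k; apply: le_trans (vc k).
by apply: (ae_le_vLnorm p1); apply: filterS wv => t ->.
Qed.

(** * The uniform boundedness principle *)

Section uniform_boundedness.
Context {R : realType} {E : lmodType R} {W : normedModType R} {I : Type}.
Variables (V : set E) (N : E -> R) (F : I -> E -> W).
Hypotheses (V0 : V 0) (VD : forall u v, V u -> V v -> V (u + v))
  (VZ : forall a u, V u -> V (a *: u)).
Hypotheses (N0 : forall u, V u -> 0 <= N u)
  (NZ : forall a u, V u -> N (a *: u) = `|a| * N u).
(* Completeness in the form of a bound on the tails of a dominated series: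
   [3 / 2 * 3^-1 ^+ n] is the sum of the [3^-1 ^+ k] with [n <= k]. *)
Hypothesis V_complete : forall v_ : nat -> E, (forall k, V (v_ k)) ->
  (forall k, N (v_ k) <= 3^-1 ^+ k) ->
  exists x, V x /\
    forall n, N (x - \sum_(0 <= k < n) v_ k) <= 3 / 2 * 3^-1 ^+ n.
Hypotheses (FD : forall i u v, V u -> V v -> F i (u + v) = F i u + F i v)
  (FZ : forall i a u, V u -> F i (a *: u) = a *: F i u).
Hypothesis F_bounded : forall i, exists C, forall u, V u -> `|F i u| <= C * N u.
Hypothesis F_pointwise : forall u, V u -> exists M, forall i, `|F i u| <= M.

Let values i := [set `|F i u| | u in [set u | V u /\ N u <= 1]].
Let opnorm i := sup (values i).

Let values_sup i : has_sup (values i).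
Proof.
split.
  exists `|F i 0|; exists 0 => //; split=> //.
  by rewrite -(scale0r 0) NZ// normr0 mul0r.
have [C FC] := F_bounded i; exists (`|C|) => _ [u [Vu Nu] <-].
apply: le_trans (FC u Vu) _; apply: (@le_trans _ _ (`|C| * N u)).
  by rewrite ler_wpM2r ?N0// ler_norm.
by rewrite ler_piMr.
Qed.

Let le_opnorm i u : V u -> `|F i u| <= opnorm i * N u.
Proof.
move=> Vu; have [Nu0|Nu0] := eqVneq (N u) 0.
  by have [C /(_ u Vu)] := F_bounded i; rewrite Nu0 !mulr0.
have Nu : 0 < N u by rewrite lt_neqAle eq_sym Nu0 N0.
rewrite -ler_pdivrMr// mulrC -[X in X * _]gtr0_norm ?invr_gt0// -normrZ -FZ//.
apply: (sup_upper_bound (values_sup i)); exists ((N u)^-1 *: u) => //; split.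
  exact: VZ.
by rewrite NZ// gtr0_norm ?invr_gt0// mulVf.
Qed.

Let opnorm_approx i : 0 < opnorm i ->
  exists u, [/\ V u, N u <= 1 & 3 / 4 * opnorm i < `|F i u|].
Proof.
move=> i0; have e0 : 0 < opnorm i / 4 by rewrite divr_gt0.
have [_ [u [Vu Nu] <-]] := sup_adherent e0 (values_sup i).
rewrite -/(opnorm i) => h; exists u; split=> //; apply: le_lt_trans h.
by lra.
Qed.

(** Sokal's proof: if the operator norms were unbounded, one could add up
    vectors of norm at most [3^-n], each with the sign that keeps the
    [n]-th operator large at the partial sum; the tail of the series is too
    short to undo this. *)
Lemma uniform_boundedness :
  exists2 K, 0 <= K & forall i u, V u -> `|F i u| <= K * N u.
Proof.
have [[K K0 FK]|unbounded] := pselect (exists2 K, 0 <= K & forall i, opnorm i <= K).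
  exists K => // i u Vu; apply: le_trans (le_opnorm i Vu) _.
  by rewrite ler_wpM2r ?N0.
have large (n : nat) : exists iu : I * E, [/\ 4 * n%:R * 3 ^+ n < opnorm iu.1,
    V iu.2, N iu.2 <= 1 & 3 / 4 * opnorm iu.1 < `|F iu.1 iu.2|].
  have A0 : 0 <= 4 * n%:R * 3 ^+ n :> R by rewrite !mulr_ge0// exprn_ge0.
  have [i ni] : exists i, 4 * n%:R * 3 ^+ n < opnorm i.
    apply: contrapT => /forallNP h; apply: unbounded.
    by exists (4 * n%:R * 3 ^+ n) => // i; rewrite leNgt; exact/negP.
  have [u [Vu Nu Fu]] := opnorm_approx (le_lt_trans A0 ni).
  by exists (i, u).
have {large}/choice[iu iuP] := large.
pose i_ n := (iu n).1; pose u_ n := 3^-1 ^+ n *: (iu n).2.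
have Vu n : V (u_ n) by apply: VZ; have [] := iuP n.
pose y_ := fix y_ n : E := if n is m.+1 then
  if `|F (i_ m) (u_ m)| <= `|F (i_ m) (y_ m + u_ m)| then y_ m + u_ m
  else y_ m - u_ m else 0.
have VN u : V u -> V (- u) by move=> Vx; rewrite -scaleN1r; exact: VZ.
have Vy n : V (y_ n).
  by elim: n => //= n ih; case: ifP => _; apply: VD => //; exact: VN.
have FN i u : V u -> F i (- u) = - F i u.
  by move=> Vx; rewrite -scaleN1r FZ// scaleN1r.
have Fy n : `|F (i_ n) (u_ n)| <= `|F (i_ n) (y_ n.+1)|.
  rewrite /=; case: ifPn => //; rewrite -ltNge FD// => lt.
  rewrite FD ?FN//; last exact: VN.
  set a := F _ (y_ n) in lt *; set z := F _ (u_ n) in lt *.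
  have : `|z *+ 2| <= `|a + z| + `|a - z|.
    suff -> : z *+ 2 = (a + z) - (a - z) by exact: ler_normB.
    by rewrite opprD opprK addrACA subrr add0r mulr2n.
  by rewrite normrMn mulr2n; lra.
have Ny n : N (y_ n.+1 - y_ n) <= 3^-1 ^+ n.
  have q0 : 0 <= 3^-1 ^+ n :> R by rewrite exprn_ge0.
  have Nu : N (u_ n) <= 3^-1 ^+ n.
    have [_ Vw Nw _] := iuP n.
    by rewrite NZ// ger0_norm// ler_piMr.
  rewrite /=; case: ifP => _; rewrite addrAC subrr add0r//.
  by rewrite -scaleN1r NZ// normrN1 mul1r.
have [x [Vx xy]] := V_complete (fun n => VD (Vy n.+1) (VN _ (Vy n))) Ny.
have [M FM] := F_pointwise Vx.
have [n Mn] : exists n : nat, M < n%:R.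
  by exists (Num.truncn M).+1; rewrite truncnS_gt.
have [ni Vw Nw Fw] := iuP n.
set q : R := 3^-1 ^+ n.
have q0 : 0 < q by rewrite exprn_gt0// invr_gt0.
have q3 : q * 3 ^+ n = 1 by rewrite -exprMn mulVf// expr1n.
have Vd : V (x - y_ n.+1) by apply: VD => //; exact: VN.
have h1 := xy n.+1; rewrite telescope_sumr// subr0 exprS -/q in h1.
have h2 := le_opnorm (i_ n) Vd.
have h3 := Fy n; rewrite /u_ FZ// normrZ gtr0_norm// -/q in h3.
have h4 : `|F (i_ n) (y_ n.+1)| <= `|F (i_ n) x| + `|F (i_ n) (x - y_ n.+1)|.
  suff -> : F (i_ n) (y_ n.+1) = F (i_ n) x - F (i_ n) (x - y_ n.+1).
    exact: ler_normB.
  by rewrite -FN// -FD ?subKr//; exact: VN.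
have h5 := FM (i_ n).
set a := opnorm (iu n).1 in ni Fw h2 *.
have a0 : 0 < a by apply: le_lt_trans ni; rewrite !mulr_ge0// exprn_ge0.
have h6 : q * (4 * n%:R * 3 ^+ n) < q * a by rewrite ltr_pM2l.
rewrite mulrCA q3 mulr1 in h6.
have h7 : q * (3 / 4 * a) < q * `|F (iu n).1 (iu n).2| by rewrite ltr_pM2l.
have h8 : a * N (x - y_ n.+1) <= a * (3 / 2 * (3^-1 * q)) by rewrite ler_pM2l.
by rewrite /i_ in h2 h3 h4 h5; lra.
Qed.

End uniform_boundedness.

(** * Inputs of finite L^p norm on the half-line *)

#[global] Instance lebesgue_ae_filter (R : realType) :
  Filter (almost_everywhere (@lebesgue_measure R)).
Proof. exact: ae_filter_ringOfSetsType. Qed.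

Section inputs.
Context {R : realType} {U : normedModType R}.
Local Notation mu := (@lebesgue_measure R).
Implicit Types u v w : R -> U.

(** An input is only almost everywhere a limit of simple functions; a
    representative is such a limit at every time and vanishes at negative times,
    so that its L^p norms over the line and the half-line agree. *)
Definition representative u (v : measurableTypeR R -> U) : Prop :=
  [/\ simple_limit v, forall t, t < 0 -> v t = 0 & input_eq `[0, +oo[ u v].

Lemma Lp_enormE (p : \bar R) u :
  Lp_enorm p u = vLnorm mu p (patch (fun=> 0) `[0, +oo[ u).
Proof.
rewrite /Lp_enorm /vLnorm; congr Lnorm; apply/funext => t.
by rewrite /patch; case: ifP => // _; rewrite normr0.
Qed.

Lemma representative_enorm (p : \bar R) u v : (1 <= p)%E -> representative u v ->
  Lp_enorm p u = vLnorm mu p v.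
Proof.
move=> p1 [_ v0 uv]; rewrite Lp_enormE; apply: ae_eq_Lnorm => //.
apply: filterS uv => t; rewrite /= in_itv/= andbT /patch.
case: ltP => [t0 _|t0 /(_ isT) <-]; last by rewrite mem_set//= in_itv/= t0.
by rewrite v0// memNset//= in_itv/= leNgt t0.
Qed.

Lemma strongly_measurable_representative u :
  strongly_measurable mu `[0, +oo[ u <-> exists v, representative u v.
Proof.
split.
  have mD : measurable (`[0%R, +oo[%classic : set (measurableTypeR R)) by [].
  move=> /(strongly_measurableP mu u mD)[v [sv v0 uv]].
  by exists v; split=> // t t0; apply: v0; rewrite /= in_itv/= leNgt t0.
move=> [v [sv v0 uv]]; apply/strongly_measurableP => //; exists v; split=> // t.
by rewrite /= in_itv/= andbT => /negP; rewrite -ltNge; exact: v0.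
Qed.

Lemma in_Lp_representative p u : in_Lp p u -> exists v, representative u v.
Proof. by case=> /strongly_measurable_representative. Qed.

Lemma representative_in_Lp p u v : (1 <= p)%E -> representative u v ->
  (vLnorm mu p v < +oo)%E -> in_Lp p u.
Proof.
move=> p1 uv vy; split; last by rewrite (representative_enorm p1 uv).
by apply/strongly_measurable_representative; exists v.
Qed.

Lemma Lp_normE p u : in_Lp p u -> (Lp_norm p u)%:E = Lp_enorm p u.
Proof. by case=> _ uy; rewrite fineK// ge0_fin_numE// Lnorm_ge0. Qed.

Lemma representative_norm p u v : (1 <= p)%E -> in_Lp p u ->
  representative u v -> vLnorm mu p v = (Lp_norm p u)%:E.
Proof. by move=> p1 pu uv; rewrite Lp_normE// (representative_enorm p1 uv). Qed.

Lemma representative_norm_le p u v (c : R) : (1 <= p)%E -> representative u v ->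
  (vLnorm mu p v <= c%:E)%E -> in_Lp p u /\ Lp_norm p u <= c.
Proof.
move=> p1 uv vc.
have pu : in_Lp p u.
  by apply: representative_in_Lp uv _ => //; rewrite (le_lt_trans vc)// ltry.
by split=> //; rewrite -lee_fin -(representative_norm p1 pu uv).
Qed.

Lemma representative0 : representative (fun=> 0) (fun=> 0).
Proof.
split=> //; first exact/simple_simple_limit/simple_cst.
by apply: aeW => t.
Qed.

Lemma representativeD u1 u2 v1 v2 : representative u1 v1 ->
  representative u2 v2 ->
  representative (fun t => u1 t + u2 t) (fun t => v1 t + v2 t).
Proof.
move=> [sv1 v10 uv1] [sv2 v20 uv2]; split; first exact: simple_limitD.
  by move=> t t0; rewrite v10// v20// addr0.
by apply: filterS2 uv1 uv2 => t e1 e2 t0; rewrite e1// e2.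
Qed.

Lemma representativeZ a u v : representative u v ->
  representative (fun t => a *: u t) (fun t => a *: v t).
Proof.
move=> [sv v0 uv]; split; first exact: simple_limitZ.
  by move=> t t0; rewrite v0// scaler0.
by apply: filterS uv => t e1 t0; rewrite e1.
Qed.

Lemma vLnorm_translation p (c : R) (v : measurableTypeR R -> U) : (1 <= p)%E ->
  simple_limit v -> vLnorm mu p (fun t => v (t + c)) = vLnorm mu p v.
Proof.
move=> p1 sv; rewrite /vLnorm unlock; case: p p1 => [r _|p1|]; last by [].
  apply: (congr1 (poweR ^~ r^-1)).
  rewrite -[RHS](ge0_integral_translation (D := setT) c
    (h := fun t => (`| `|v t|%:E | `^ r)%E)) ?preimage_setT//.
  - apply: (measurableT_comp (measurable_poweR r)); apply: measurableT_comp => //.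
    exact/measurable_EFinP/simple_limit_measurable_norm.
  - by move=> t _; exact: poweR_ge0.
have le (c' : R) (w : R -> U) : (ess_sup mu (abse \o (fun t => `|w (t + c')%R|%:E)) <=
    ess_sup mu (abse \o (fun t => `|w t|%:E)))%E.
  apply/ess_supP.
  exact: (ae_translation c' (ess_sup_ge mu (abse \o (fun t => `|w t|%:E)))).
case: ifPn => // _; apply/eqP; rewrite eq_le le/=.
apply: le_trans (le (- c) (fun t => v (t + c)%R)).
by apply: le_ess_sup; apply: aeW => t /=; rewrite subrK.
Qed.

Lemma representative_shift (tau : R) u v : 0 <= tau -> representative u v ->
  representative (shift_input tau u)
    (patch (fun=> 0) `[0, +oo[ (fun t => v (t + tau))).
Proof.
move=> tau0 [sv v0 uv]; split.
- apply: simple_limit_patch => //; first exact: simple_limit_translation.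
  exact/simple_simple_limit/simple_cst.
- by move=> t t0; rewrite /patch memNset//= in_itv/= leNgt t0.
apply: filterS (ae_translation tau uv) => t /= e; rewrite in_itv/= andbT => t0.
rewrite /patch mem_set//= ?in_itv/= ?t0// /shift_input e//.
by rewrite in_itv/= andbT addr_ge0.
Qed.

Lemma representative_concat (tau : R) u1 u2 v1 v2 : 0 <= tau ->
  representative u1 v1 -> representative u2 v2 ->
  representative (concat_input tau u1 u2)
    (fun t => patch (fun=> 0) `]-oo, tau[ v1 t + v2 (t - tau)).
Proof.
move=> tau0 [sv1 v10 uv1] [sv2 v20 uv2]; split.
- apply: simple_limitD; last exact: simple_limit_translation.
  by apply: simple_limit_patch => //; exact/simple_simple_limit/simple_cst.
- move=> t t0; rewrite v20 ?addr0.
    by rewrite /patch; case: ifP => // _; exact: v10.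
  by rewrite subr_lt0 (lt_le_trans t0).
apply: filterS2 uv1 (ae_translation (- tau) uv2) => t /= e1 e2.
rewrite in_itv/= andbT => t0; rewrite /concat_input; case: ltP => ttau.
  rewrite v20 ?subr_lt0// addr0 /patch mem_set//=.
  by rewrite e1// in_itv/= t0.
rewrite /patch memNset ?add0r//= ?in_itv/= ?ltNge ?ttau//.
by rewrite e2// in_itv/= subr_ge0 ttau.
Qed.

Section exponent.
Variable p : \bar R.
Hypothesis p1 : (1 <= p)%E.

Lemma in_Lp0 : in_Lp p (fun=> 0 : U).
Proof.
by apply: (representative_in_Lp p1 representative0); rewrite vLnorm0// ltry.
Qed.

Lemma in_LpD_norm u v : in_Lp p u -> in_Lp p v ->
  in_Lp p (fun t => u t + v t) /\
  Lp_norm p (fun t => u t + v t) <= Lp_norm p u + Lp_norm p v.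
Proof.
move=> pu pv; have [u' uu'] := in_Lp_representative pu.
have [v' vv'] := in_Lp_representative pv.
apply: (representative_norm_le p1 (representativeD uu' vv')).
rewrite EFinD -(representative_norm p1 pu uu') -(representative_norm p1 pv vv').
by apply: vLnormD => //; [case: uu'|case: vv'].
Qed.

Lemma in_LpZ_norm a u : in_Lp p u ->
  in_Lp p (fun t => a *: u t) /\ Lp_norm p (fun t => a *: u t) = `|a| * Lp_norm p u.
Proof.
move=> pu; have [v uv] := in_Lp_representative pu.
have auv := representativeZ a uv.
have sv : simple_limit v by case: uv.
have vE := vLnormZ mu p1 a sv.
have pau : in_Lp p (fun t => a *: u t).
  apply: (representative_in_Lp p1 auv).
  by rewrite vE (representative_norm p1 pu uv) ltry.
split=> //; apply/EFin_inj.
by rewrite EFinM -(representative_norm p1 pau auv) vE (representative_norm p1 pu uv).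
Qed.

Lemma Lp_norm_ge0 u : 0 <= Lp_norm p u.
Proof. by rewrite fine_ge0// Lnorm_ge0. Qed.

Lemma Lp_norm_is_norm : is_norm_on (in_Lp p : set (R -> U)) (Lp_norm p).
Proof.
split.
- split; first exact: in_Lp0.
    by move=> u v pu pv; case: (in_LpD_norm pu pv).
  by move=> a u pu; case: (in_LpZ_norm a pu).
- move=> u v pu pv uv; apply/EFin_inj; rewrite !Lp_normE// !Lp_enormE.
  apply: ae_eq_Lnorm => //; apply: filterS uv => t uvt.
  by rewrite /patch; case: ifPn => //; rewrite inE => /uvt ->.
- by move=> u v pu pv; case: (in_LpD_norm pu pv).
- by move=> a u pu; case: (in_LpZ_norm a pu).
move=> u pu u0; have [v uv] := in_Lp_representative pu.
have [sv _ uv0] := uv; have vN := representative_norm p1 pu uv.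
rewrite u0 in vN; apply: filterS2 uv0 (vLnorm_eq0 p1 sv vN) => t e v0 t0.
by rewrite e// v0.
Qed.

Lemma shift_input_Lp u (tau : R) : in_Lp p u -> 0 <= tau ->
  in_Lp p (shift_input tau u) /\ Lp_norm p (shift_input tau u) <= Lp_norm p u.
Proof.
move=> pu tau0; have [v uv] := in_Lp_representative pu; have [sv _ _] := uv.
apply: (representative_norm_le p1 (representative_shift tau0 uv)).
rewrite -(representative_norm p1 pu uv) -(vLnorm_translation tau p1 sv).
apply: ae_le_vLnorm => //; apply: aeW => t.
by rewrite /patch; case: ifP => // _; rewrite normr0.
Qed.

Lemma concat_input_Lp u1 u2 (tau : R) : in_Lp p u1 -> in_Lp p u2 -> 0 <= tau ->
  in_Lp p (concat_input tau u1 u2).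
Proof.
move=> pu1 pu2 tau0; have [v1 uv1] := in_Lp_representative pu1.
have [v2 uv2] := in_Lp_representative pu2.
have [sv1 _ _] := uv1; have [sv2 _ _] := uv2.
apply: (representative_in_Lp p1 (representative_concat tau0 uv1 uv2)).
apply: le_lt_trans (vLnormD mu p1 _ _) _.
- by apply: simple_limit_patch => //; exact/simple_simple_limit/simple_cst.
- exact: simple_limit_translation.
rewrite vLnorm_translation// (representative_norm p1 pu2 uv2).
rewrite lte_add_pinfty ?ltry//.
apply: (@le_lt_trans _ _ (vLnorm mu p v1)).
  apply: ae_le_vLnorm => //; apply: aeW => t.
  by rewrite /patch; case: ifP => // _; rewrite normr0.
by rewrite (representative_norm p1 pu1 uv1) ltry.
Qed.

(** After normalisation this is [a <= 1 + a ^ r], for every finite exponent. *)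
Lemma integral_norm_le_vLnorm (v : measurableTypeR R -> U) (n t : R) : 0 <= t ->
  simple_limit v -> vLnorm mu p v = n%:E ->
  (\int[mu]_(s in `[0%R, t]) `|v s|%:E <= ((t + 1) * n)%:E)%E.
Proof.
move=> t0 sv vn.
have n0 : 0 <= n by rewrite -lee_fin -vn; exact: vLnorm_ge0.
have mt : mu `[0, t] = t%:E.
  rewrite lebesgue_measure_itv/= lte_fin; case: ltgtP t0 => // [t0 _|<- _//].
  by rewrite -EFinD subr0.
have mnv := simple_limit_measurable_norm sv.
case: p p1 vn => [r||]// => [|_ vn].
  rewrite lee_fin => r1 vn; have r0 : 0 < r by rewrite (lt_le_trans _ r1).
  have [nz|nz] := eqVneq n 0.
    have v0 := vLnorm_eq0 (p := r%:E) r1 sv (etrans vn (congr1 EFin nz)).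
    rewrite (@ae_eq_ge0_integral _ _ _ _ _ _ (cst 0%E))//; last first.
      by apply: filterS v0 => s -> _; rewrite normr0.
    by rewrite integral0 nz mulr0.
  have np : 0 < n by rewrite lt_neqAle eq_sym nz n0.
  have mpow : measurable_fun `[0, t]
      (fun s : measurableTypeR R => ((n^-1 * `|v s|) `^ r)%:E).
    apply/measurable_EFinP; apply: measurable_funTS.
    by apply: (measurableT_comp (measurable_powR r)); exact: measurable_funM.
  apply: (@le_trans _ _ (\int[mu]_(s in `[0%R, t])
      (n%:E * (1 + ((n^-1 * `|v s|) `^ r)%:E)))%E).
    apply: ae_le_ge0_integral => // [s _|].
      by rewrite mule_ge0// ?lee_fin// addr_ge0// powR_ge0.
    apply: aeW => s _; rewrite -EFinD -EFinM lee_fin -ler_pdivrMl//.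
    have [a1|a1] := leP (n^-1 * `|v s|) 1; first by rewrite (le_trans a1)// lerDl powR_ge0.
    by rewrite (@le_trans _ _ ((n^-1 * `|v s|) `^ r))// ?lerDr// le1r_powR// ltW.
  rewrite ge0_integralZl_EFin//; last 2 first.
  - by move=> s _; rewrite adde_ge0// lee_fin powR_ge0.
  - exact: emeasurable_funD.
  rewrite mulrC EFinM; apply: lee_wpmul2l => //.
  rewrite ge0_integralD//; last by move=> s _; rewrite lee_fin powR_ge0.
  rewrite integral_cst//= mul1e EFinD; apply: leeD; first by rewrite mt.
  have N1 : (vLnorm mu r%:E (fun s => n^-1 *: v s) <= 1%:E)%E.
    by rewrite vLnormZ// vn gtr0_norm ?invr_gt0// -EFinM mulVf.
  have := (Lnorm_le_poweR mu _ r1 ler01).1 N1; rewrite poweR1r.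
  move=> h; apply: le_trans h; rewrite [X in (X <= _)%E]integral_mkcond.
  apply: ae_le_ge0_integral => //.
  - by move=> s _; rewrite /patch; case: ifP => // _; rewrite lee_fin powR_ge0.
  - by move=> s _; exact: poweR_ge0.
  apply: aeW => s _; rewrite /patch; case: ifP => _; last exact: poweR_ge0.
  by rewrite abse_EFin normr_id normrZ gtr0_norm ?invr_gt0.
have mu0 : (0 < mu [set: R])%E.
  apply: (@lt_le_trans _ _ (mu `[0, 1])).
    by rewrite lebesgue_measure_itv/= lte_fin ltr01 sube0 lte_fin.
  by apply: le_measure => //; rewrite inE.
apply: (@le_trans _ _ (\int[mu]_(s in `[0%R, t]) n%:E)%E).
  apply: ae_le_ge0_integral => //; move: vn; rewrite /vLnorm unlock mu0 => vn.
  apply: filterS (ess_sup_ge mu (abse \o (fun s => `|v s|%:E))) => s /=.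
  by rewrite normr_id vn => + _.
by rewrite integral_cst//= [X in (_ * X)%E]mt -EFinM lee_fin mulrC ler_wpM2r// lerDl.
Qed.

End exponent.
End inputs.

Lemma geometric_third_sum {R : realFieldType} (m n : nat) :
  \sum_(m <= k < n) 3^-1 ^+ k <= 3 / 2 * 3^-1 ^+ m :> R.
Proof.
have q0 k : 0 <= 3^-1 ^+ k :> R by rewrite exprn_ge0.
have [mn|nm] := leqP m n; last by rewrite big_geq ?mulr_ge0// ltnW.
rewrite (eq_bigr (fun k => - (3 / 2 * 3^-1 ^+ k.+1) - - (3 / 2 * 3^-1 ^+ k))).
  rewrite (telescope_sumr (fun k => - (3 / 2 * 3^-1 ^+ k)))//.
  by rewrite opprK addrC lerBlDr lerDl mulr_ge0.
by move=> k _; rewrite exprS; lra.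
Qed.

Section Lp_complete.
Context {R : realType} {U : completeNormedModType R}.
Variable p : \bar R.
Hypothesis p1 : (1 <= p)%E.
Local Notation mu := (@lebesgue_measure R).

(** The series of representatives converges in L^p of the line, and its sum is
    set to zero at negative times. *)
Lemma in_Lp_series (u_ : nat -> R -> U) : (forall k, in_Lp p (u_ k)) ->
  (forall k, Lp_norm p (u_ k) <= 3^-1 ^+ k) ->
  exists x : R -> U, in_Lp p x /\
    forall n, Lp_norm p (x - \sum_(0 <= k < n) u_ k) <= 3 / 2 * 3^-1 ^+ n.
Proof.
move=> pu uN.
have /choice[v_ uv] k : exists v, representative (u_ k) v.
  exact: in_Lp_representative (pu k).
have sv k : simple_limit (v_ k) by case: (uv k).
have vN k : (vLnorm mu p (v_ k) <= (3^-1 ^+ k)%:E)%E.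
  by rewrite (representative_norm p1 (pu k) (uv k)) lee_fin.
have [x [sx xN]] := vLnorm_series p1 sv vN geometric_third_sum.
pose y : measurableTypeR R -> U := patch (fun=> 0) `[0, +oo[ x.
have ry : representative (y : R -> U) y.
  split; last exact: aeW.
    by apply: simple_limit_patch => //; exact/simple_simple_limit/simple_cst.
  by move=> t t0; rewrite /y /patch memNset//= in_itv/= leNgt t0.
have sumE n t : (\sum_(0 <= k < n) u_ k) t = \sum_(0 <= k < n) u_ k t.
  by rewrite fct_sumE.
have le n : (Lp_enorm p (y - \sum_(0 <= k < n) u_ k)%R <=
    (3 / 2 * 3^-1 ^+ n)%:E)%E.
  rewrite Lp_enormE; apply: le_trans (xN n); apply: ae_le_vLnorm => //.
  have uv_ae : {ae mu, forall t, forall k, `[0, +oo[%classic t -> u_ k t = v_ k t}.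
    by apply: ae_foralln => k; case: (uv k).
  apply: filterS uv_ae => t uvt; rewrite /patch; case: ifPn; last by rewrite normr0.
  rewrite inE => t0; rewrite (_ : (y - _) t = y t - (\sum_(0 <= k < n) u_ k) t)//.
  rewrite sumE /y /patch mem_set//.
  by rewrite (eq_bigr (fun k => v_ k t))// => k _; exact: uvt.
have py : in_Lp p y.
  split; first by apply/strongly_measurable_representative; exists y.
  have := le 0; rewrite big_geq// subr0 => /le_lt_trans; apply.
  exact: ltry.
exists y; split=> // n; rewrite -lee_fin /Lp_norm fineK//.
by rewrite ge0_fin_numE ?Lnorm_ge0// (le_lt_trans (le n))// ltry.
Qed.

Lemma Lp_uniform_boundedness {W : normedModType R} {I : Type}
    (F : I -> (R -> U) -> W) :
  (forall i u v, in_Lp p u -> in_Lp p v -> F i (u + v) = F i u + F i v) ->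
  (forall i a u, in_Lp p u -> F i (a *: u) = a *: F i u) ->
  (forall i, exists C, forall u, in_Lp p u -> `|F i u| <= C * Lp_norm p u) ->
  (forall u, in_Lp p u -> exists M, forall i, `|F i u| <= M) ->
  exists2 K, 0 <= K & forall i u, in_Lp p u -> `|F i u| <= K * Lp_norm p u.
Proof.
move=> FD FZ Fb Fp; apply: uniform_boundedness => //.
- exact: in_Lp0.
- by move=> u v pu pv; case: (in_LpD_norm p1 pu pv).
- by move=> a u pu; case: (in_LpZ_norm p1 a pu).
- by move=> u _; exact: Lp_norm_ge0.
- by move=> a u pu; case: (in_LpZ_norm p1 a pu).
- exact: in_Lp_series.
Qed.

End Lp_complete.

(** * Continuity of translations in L^p *)

Section translation_continuity.
Context {R : realType}.
Local Notation mu := (@lebesgue_measure R).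

(** A compact set inside [E] is moved by a small translation into an open
    set around [E]; both differ from [E] by a set of small measure. *)
Lemma measure_translation_diff (E : set (measurableTypeR R)) (e : R) :
  measurable E -> (mu E < +oo)%E -> 0 < e ->
  \forall h \near (0 : R), (mu ((fun x => (x + h)%R) @^-1` E `\` E) <= e%:E)%E.
Proof.
move=> mE muE e0; have e2 : 0 < e / 2 by rewrite divr_gt0.
have [G [oG EG GE]] := lebesgue_regularity_outer mE muE e2.
have [K [cK KE EK]] := lebesgue_regularity_inner mE muE e2.
have mG : measurable (G : set (measurableTypeR R)) by exact: open_measurable.
have mK : measurable (K : set (measurableTypeR R)) by exact: compact_measurable.
have KG : \forall h \near (0 : R), K `<=` [set x | G (x - h)].
  have /compact_near_coveringP cK' := cK.
  apply: (cK' R (nbhs (0:R)) (fun h x => G (x - h))) => x Kx.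
  have : (fun yh : R * R => yh.1 - yh.2) yh @[yh --> (x, 0 : R)] --> x - 0.
    by apply: cvgB; [exact: cvg_fst|exact: cvg_snd].
  apply; rewrite subr0; apply: open_nbhs_nbhs; split=> //.
  exact/EG/KE.
apply: filterS KG => h KG.
have mtr (A : set (measurableTypeR R)) : measurable A ->
  measurable ((fun x => x + h) @^-1` A : set (measurableTypeR R)).
  exact: measurable_translation.
have mEK : measurable (E `\` K : set (measurableTypeR R)) by exact: measurableD.
have mGE : measurable (G `\` E : set (measurableTypeR R)) by exact: measurableD.
apply: (@le_trans _ _ (mu (G `\` E) + mu ((fun x => (x + h)%R) @^-1` (E `\` K)))%E).
  apply: le_trans (measureU2 mu mGE (mtr _ mEK)).
  apply: le_measure; rewrite ?inE.
  - by apply: measurableD => //; exact: mtr.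
  - by apply: measurableU => //; exact: mtr.
  move=> x [/= Exh Ex]; have [Kxh|Kxh] := pselect (K (x + h)); last by right.
  by left; split=> //; have := KG _ Kxh; rewrite /= addrK.
rewrite (lebesgue_measure_translation h mEK) (splitr e) EFinD.
by apply: leeD; exact: ltW.
Qed.

Context {U : normedModType R}.
Variable r : R.
Hypothesis r1 : 1 <= r.
Implicit Types v w : measurableTypeR R -> U.

Definition translation_continuous v : Prop := forall e : R, 0 < e ->
  \forall h \near (0 : R),
    (vLnorm mu r%:E (fun t => v (t + h)%R - v t)%R <= e%:E)%E.

Lemma translation_continuous0 v : (forall t, v t = 0) ->
  translation_continuous v.
Proof.
move=> v0 e e0; apply: (@nearW _ (nbhs (0 : R))) => h.
rewrite (_ : vLnorm _ _ _ = 0%E) ?lee_fin ?ltW//.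
rewrite -[RHS](vLnorm0 (Y := U) mu (p := r%:E) r1); congr vLnorm.
by apply/funext => t; rewrite !v0 subrr.
Qed.

Lemma translation_continuousD v w : simple_limit v -> simple_limit w ->
  translation_continuous v -> translation_continuous w ->
  translation_continuous (fun t => v t + w t).
Proof.
move=> sv sw cv cw e e0; have e2 : 0 < e / 2 by rewrite divr_gt0.
apply: filterS2 (cv _ e2) (cw _ e2) => h vh wh.
rewrite (_ : (fun t => _) = (fun t => (v (t + h) - v t) + (w (t + h) - w t))); last first.
  by apply/funext => t; rewrite opprD addrACA.
apply: (le_trans (vLnormD _ _ _ _)) => //.
- by apply: simple_limitB => //; exact: simple_limit_translation.
- by apply: simple_limitB => //; exact: simple_limit_translation.
by rewrite (splitr e) EFinD leeD.
Qed.

Lemma translation_continuous_indic (E : set (measurableTypeR R)) (y : U) :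
  measurable E -> (mu E < +oo)%E ->
  translation_continuous (patch (fun=> 0) E (fun=> y)).
Proof.
move=> mE muE e e0; have r0 : 0 < r by rewrite (lt_le_trans _ r1).
have [y0|y0] := eqVneq y 0.
  by apply: translation_continuous0 => // t; rewrite /patch y0 if_same.
have yp : 0 < `|y| `^ r by rewrite powR_gt0// normr_gt0.
pose e' := e `^ r / (`|y| `^ r) / 2.
have e'0 : 0 < e' by rewrite !divr_gt0// powR_gt0.
have near1 := measure_translation_diff mE muE e'0.
have near2 : \forall h \near (0 : R),
    (mu ((fun x => (x - h)%R) @^-1` E `\` E) <= e'%:E)%E.
  have cN : (- h) @[h --> (0 : R)] --> (- 0 : R) by exact: opp_continuous.
  by rewrite oppr0 in cN; exact: (cN _ near1).
apply: filterS2 near1 near2 => h.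
set A1 := _ `\` E; set A2 := _ `\` E => m1 m2.
have mtr c (A : set (measurableTypeR R)) : measurable A ->
  measurable ((fun x => x + c) @^-1` A : set (measurableTypeR R)).
  exact: measurable_translation.
have mA1 : measurable A1 by apply: measurableD => //; exact: mtr.
have mA2 : measurable A2 by apply: measurableD => //; exact: mtr.
pose A3 := (fun x => x + h) @^-1` A2 : set (measurableTypeR R).
have mA3 : measurable A3 by exact: mtr.
have m3 : mu A3 = mu A2 by exact: lebesgue_measure_translation.
apply/(Lnorm_le_poweR mu _ r1 (ltW e0)).
apply: (@le_trans _ _ (\int[mu]_x ((`|y| `^ r)%:E * (\1_(A1 `|` A3) x)%:E))%E).
  apply: ae_le_ge0_integral => [x _|x _|]; [exact: poweR_ge0|
    by rewrite mule_ge0// lee_fin ?powR_ge0|].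
  apply: aeW => x _; rewrite abse_EFin normr_id poweR_EFin -EFinM lee_fin.
  rewrite indicE; have [Exh|Exh] := pselect (E (x + h));
      have [Ex|Ex] := pselect (E x); rewrite /patch.
  - by rewrite (mem_set Exh) (mem_set Ex) subrr normr0 powR0 ?gt_eqF// mulr_ge0// powR_ge0.
  - rewrite (mem_set Exh) (memNset Ex) subr0 (mem_set (_ : (A1 `|` A3) x)) ?mulr1//.
    by left.
  - rewrite (memNset Exh) (mem_set Ex) sub0r normrN (mem_set (_ : (A1 `|` A3) x)) ?mulr1//.
    by right; split=> //=; rewrite addrK.
  - by rewrite (memNset Exh) (memNset Ex) subrr normr0 powR0 ?gt_eqF// mulr_ge0// powR_ge0.
rewrite ge0_integralZl_EFin ?powR_ge0//; last first.
  by apply/measurable_EFinP; apply: measurable_indic; exact: measurableU.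
rewrite integral_indic//; last exact: measurableU.
rewrite setIT poweR_EFin.
apply: (@le_trans _ _ ((`|y| `^ r)%:E * (e'%:E + e'%:E))%E).
  rewrite lee_pmul2l ?lte_fin//; apply: (le_trans (measureU2 mu mA1 mA3)).
  exact: (leeD m1 (eq_ind_r (fun z => (z <= e'%:E)%E) m2 m3)).
by rewrite -EFinD -EFinM lee_fin /e' -splitr mulrC divfK ?gt_eqF.
Qed.

Lemma translation_continuous_simple v : simple_function v ->
  (forall y, y != 0 -> (mu (v @^-1` [set y]) < +oo)%E) ->
  translation_continuous v.
Proof.
move=> sv vfin; have [s us vs] := simple_range sv.
pose term y := patch (fun=> 0) (v @^-1` [set y]) (fun=> y) : measurableTypeR R -> U.
have mlev y : measurable (v @^-1` [set y]) by exact: simple_preimage.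
have sterm y : simple_limit (term y).
  by apply: simple_limit_patch => //; exact/simple_simple_limit/simple_cst.
have vE : v = fun t => \sum_(y <- s) term y t.
  apply/funext => t; rewrite (bigD1_seq (v t))//= big1_seq ?addr0.
    by rewrite /term /patch mem_set.
  by move=> y /andP[/eqP yv _]; rewrite /term /patch memNset//= => /esym.
rewrite vE; elim: s {us vs vE} => [|y s ih].
  by apply: translation_continuous0 => t; rewrite big_nil.
under eq_fun do rewrite big_cons; apply: translation_continuousD => //.
- elim: s {ih} => [|z s ih].
    by under eq_fun do rewrite big_nil; exact/simple_simple_limit/simple_cst.
  by under eq_fun do rewrite big_cons; exact: simple_limitD.
have [->|y0] := eqVneq y 0.
  by apply: translation_continuous0 => t; rewrite /term /patch if_same.
exact: translation_continuous_indic (vfin y y0).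
Qed.

(** Simple functions dominated by [2 * `|v|] are restricted to growing bounded
    intervals, which makes the measures of their levels finite. *)
Lemma vLnorm_simple_approx v (e : R) : simple_limit v ->
  (vLnorm mu r%:E v < +oo)%E -> 0 < e ->
  exists w, [/\ simple_function w,
    forall y, y != 0 -> (mu (w @^-1` [set y]) < +oo)%E &
    (vLnorm mu r%:E (fun t => v t - w t)%R <= e%:E)%E].
Proof.
move=> sv vfin e0; have r0 : 0 < r by rewrite (lt_le_trans _ r1).
have rn0 : r != 0 by rewrite gt_eqF.
have [s [ss sc sle]] := simple_limit_dominated sv.
pose D (n : nat) : set (measurableTypeR R) := `[- n%:R, n%:R]%classic.
pose w n := patch (fun=> 0) (D n) (s n).
have sw n : simple_function (w n).
  by apply: simple_patch; [exact: measurable_itv|exact: ss|exact: simple_cst].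
have wle n t : `|v t - w n t| <= 3 * `|v t|.
  rewrite (le_trans (ler_normB _ _))//.
  suff : `|w n t| <= 2 * `|v t| by lra.
  by rewrite /w /patch; case: ifP => // _; rewrite normr0 mulr_ge0.
have wv t : w n t @[n --> \oo] --> v t.
  apply: (@cvg_trans _ (s n t @[n --> \oo])); last exact: sc.
  apply: near_eq_cvg; exists (Num.truncn `|t|).+1 => // n /= tn.
  rewrite /w /patch mem_set// /D /= in_itv/= -ler_norml.
  by rewrite (le_trans (ltW (truncnS_gt _)))// ler_nat.
have smv n : simple_limit (fun t => v t - w n t).
  by apply: simple_limitB => //; exact: simple_simple_limit.
pose F n (t : measurableTypeR R) := (`|v t - w n t|%:E `^ r)%E.
have mF n : measurable_fun [set: measurableTypeR R] (F n).
  apply: (measurableT_comp (measurable_poweR r)); apply/measurable_EFinP.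
  exact: simple_limit_measurable_norm.
have F0 t : F n t @[n --> \oo] --> 0%E.
  rewrite -[X in _ --> X](poweR0r rn0).
  apply: cvg_poweR => //.
  apply: cvg_EFin; first exact: nearW.
  rewrite -(normr0 U) -(subrr (v t)); apply: cvg_norm.
  by apply: cvgB => //; exact: cvg_cst.
pose G (t : measurableTypeR R) := ((3 `^ r)%:E * `| `|v t|%:E | `^ r)%E.
have iG : mu.-integrable [set: measurableTypeR R] G.
  apply: integrableZl => //; apply/integrableP; split.
    apply: (measurableT_comp (measurable_poweR r)); apply: measurableT_comp => //.
    exact/measurable_EFinP/simple_limit_measurable_norm.
  under eq_integral do rewrite gee0_abs ?poweR_ge0//.
  by rewrite -poweR_Lnorm ?gt_eqF// poweR_lty.
have FG n t : (`|F n t| <= G t)%E.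
  rewrite gee0_abs ?poweR_ge0// /F /G abse_EFin normr_id !poweR_EFin -EFinM lee_fin.
  by rewrite -powRM// ge0_ler_powR ?nnegrE ?mulr_ge0// ltW.
have [_ _] := dominated_convergence measurableT mF (measurable_cst 0%E)
  (aeW _ (fun t _ => F0 t)) iG (aeW _ (fun t n _ => FG n t)).
rewrite integral0 => /(ge0_cvge0P (fun n => integral_ge0 _ (fun t _ => poweR_ge0 _ _))).
move=> /(_ (e `^ r) (powR_gt0 _ e0))[n _ /(_ n (leqnn n)) Fe].
exists (w n); split=> // [y y0|].
  have Dn : (mu (D n) < +oo)%E.
    by rewrite /D lebesgue_measure_itv/=; case: ifP => _; rewrite ?ltry.
  apply: le_lt_trans Dn; apply: le_measure; rewrite ?inE.
  - exact: simple_preimage.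
  - exact: measurable_itv.
  move=> t; rewrite /= /w /patch; case: ifPn; first by rewrite inE.
  by move=> _ y0'; rewrite -y0' eqxx in y0.
apply/(Lnorm_le_poweR mu _ r1 (ltW e0)); apply: le_trans (ltW Fe).
by apply: ae_le_ge0_integral => [t _|t _|]; [exact: poweR_ge0..|
  apply: aeW => t _; rewrite abse_EFin normr_id].
Qed.

Lemma vLnorm_translation_continuous v : simple_limit v ->
  (vLnorm mu r%:E v < +oo)%E -> translation_continuous v.
Proof.
move=> sv vfin e e0; have e3 : 0 < e / 3 by rewrite divr_gt0.
have [w [sw wfin vw]] := vLnorm_simple_approx sv vfin e3.
have slw := simple_simple_limit sw.
apply: filterS (translation_continuous_simple sw wfin e3) => h wh.
have svw : simple_limit (fun t => v t - w t) by exact: simple_limitB.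
have swh : simple_limit (fun t : measurableTypeR R => w (t + h) - w t).
  by apply: simple_limitB => //; exact: simple_limit_translation.
have svwh := simple_limit_translation h svw.
have -> : (fun t : measurableTypeR R => v (t + h) - v t) =
    (fun t : measurableTypeR R => ((v (t + h) - w (t + h)) +
      (w (t + h) - w t)) + (-1) *: (v t - w t)).
  by apply/funext => t; rewrite scaleN1r opprB subrKA subrKA.
apply: le_trans (vLnormD mu _ (simple_limitD svwh swh) (simple_limitZ (-1) svw)) _.
  by [].
rewrite vLnormZ// normrN1 mul1e.
rewrite (_ : e%:E = (e / 3)%:E + (e / 3)%:E + (e / 3)%:E)%E; last first.
  by rewrite -!EFinD; congr EFin; lra.
apply: leeD => //; apply: le_trans (vLnormD mu _ svwh swh) _ => //.
apply: leeD => //.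
by rewrite (vLnorm_translation (p := r%:E) h _ svw).
Qed.

End translation_continuity.

(** * Strongly continuous semigroups *)

Lemma within_halfline_continuousP {R : realType} {X : normedModType R}
    (f : R -> X) :
  {within `[0, +oo[, continuous f} <->
  forall t0 e : R, 0 <= t0 -> 0 < e -> exists2 d, 0 < d &
    forall t, 0 <= t -> `|t - t0| < d -> `|f t - f t0| < e.
Proof.
split=> [/subspace_continuousP cf t0 e t00 e0|H].
  have /cvgrPdist_lt/(_ e e0) : f @ within `[0, +oo[%classic (nbhs t0) --> f t0.
    by apply: cf; rewrite /= in_itv/= t00.
  move=> [d /= d0 H]; exists d => // t t0' td.
  rewrite distrC; apply: H; rewrite /= ?in_itv/= ?t0'//.
  by rewrite distrC.
apply/subspace_continuousP => t0 /=; rewrite in_itv/= andbT => t00.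
apply/cvgrPdist_lt => e e0; have [d d0 Hd] := H t0 e t00 e0.
exists d => //= t td; rewrite in_itv/= andbT => t0'.
by rewrite distrC Hd// distrC.
Qed.

Section semigroup.
Import HBNNSimple.
Context {R : realType} {Y : completeNormedModType R}.
Variable S : R -> {linear Y -> Y}.
Hypothesis hS : C0_semigroup S.

Let near0 (y : Y) (e : R) : 0 < e ->
  exists2 d, 0 < d & forall t, 0 <= t < d -> `|S t y - y| < e.
Proof.
move=> e0.
have cy : S t y @[t --> 0^'+] --> y by exact: semigroup_strongly_continuous.
have [d /= d0 Hd] := (cvgrPdist_lt _ _).1 cy e e0.
exists d => // t /andP[t0 td]; have [->|tn0] := eqVneq t 0.
  by rewrite (semigroup0 hS) subrr normr0.
rewrite distrC; apply: Hd => /=; last by rewrite lt_neqAle eq_sym tn0.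
by rewrite sub0r normrN ger0_norm.
Qed.

(** Otherwise some [S (t n)] with [t n] tending to [0] would have norms tending
    to infinity, although they converge pointwise. *)
Let bound_near0 : exists2 d, 0 < d & exists2 M, 1 <= M &
  forall t y, 0 <= t <= d -> `|S t y| <= M * `|y|.
Proof.
apply: contrapT => nb.
have /choice[ty tyP] (n : nat) : exists ty : R * Y,
    [/\ 0 <= ty.1, ty.1 <= n.+1%:R^-1 & n.+1%:R * `|ty.2| < `|S ty.1 ty.2|].
  apply: contrapT => /forallNP H; apply: nb.
  exists n.+1%:R^-1; first by rewrite invr_gt0.
  exists n.+1%:R; first by rewrite ler1n.
  move=> t y /andP[t0 tn]; rewrite leNgt; apply/negP => h.
  by apply: (H (t, y)).
pose F : set (Y -> Y) := range (fun n => S (ty n).1 : Y -> Y).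
have Flin f : F f -> bounded_fun_norm f /\ linear f.
  move=> [n _ <-]; have [t0 _ _] := tyP n; split; last exact: linearP.
  have [M M0 SM] := linear_bound (semigroup_bounded hS t0).
  by move=> r; exists (M * r) => x xr; rewrite (le_trans (SM x))// ler_pM2l.
have Fpt : pointwise_bounded F.
  move=> y; have cv : cvgn (fun n => `|S (ty n).1 y|).
    apply/cvg_ex; exists `|y|; apply: cvg_norm; apply/cvgrPdist_lt => e e0.
    have [d' d'0 Hd'] := near0 y e0.
    near=> n; rewrite distrC; apply: Hd'.
    have [-> tn _] := tyP n; rewrite (le_lt_trans tn)//=.
    by near: n; exact: near_infty_natSinv_lt (PosNum d'0).
  have [M [_ HM]] := cvg_seq_bounded cv.
  exists (M + 1) => _ [n _ <-].
  have M1 : M < M + 1 by rewrite ltrDl.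
  have /= := HM (M + 1) M1 n I.
  by rewrite normr_id.
have [M HM] := Banach_Steinhauss Flin Fpt 1.
have [n Mn] : exists n : nat, M < n%:R.
  by exists (Num.truncn M).+1; rewrite truncnS_gt.
have [t0 _ Sn] := tyP n.
have y0 : 0 < `|(ty n).2|.
  rewrite normr_gt0; apply/eqP => y0; move: Sn.
  by rewrite y0 linear0 normr0 mulr0 ltxx.
have := HM _ (ex_intro2 _ _ n I erefl) (`|(ty n).2|^-1 *: (ty n).2).
rewrite normrZ normfV normr_id mulVf ?gt_eqF// => /(_ (lexx _)).
rewrite linearZ normrZ normfV normr_id ler_pdivrMl// => h.
have := lt_le_trans Sn h; rewrite mulrC ltr_pM2l// => nM.
have nS : n%:R < n.+1%:R :> R by rewrite ltr_nat.
by have := lt_trans Mn (lt_trans nS nM); rewrite ltxx.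
Unshelve. all: by end_near. Qed.

(** The bound near time zero propagates by the semigroup law. *)
Lemma semigroup_bound (t1 : R) : exists2 M, 0 < M &
  forall t y, 0 <= t <= t1 -> `|S t y| <= M * `|y|.
Proof.
have [d d0 [M M1 SM]] := bound_near0.
have M0 : 0 < M by rewrite (lt_le_trans ltr01).
have Sn (n : nat) t y : 0 <= t <= n.+1%:R * d -> `|S t y| <= M ^+ n.+1 * `|y|.
  elim: n t => [|n ih] t; first by rewrite mul1r expr1; exact: SM.
  move=> /andP[t0 tn]; have [td|dt] := leP t d.
    apply: (le_trans (SM t y _)); first by rewrite t0.
    by rewrite ler_wpM2r// ler_eXnr.
  have td0 : 0 <= t - d by rewrite subr_ge0 ltW.
  rewrite -(subrKC d t) (semigroupD hS _ (ltW d0) td0).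
  apply: (le_trans (SM _ _ _)); first by rewrite lexx ltW.
  rewrite exprS -mulrA ler_pM2l//; apply: ih.
  by rewrite td0 lerBlDr; move: tn; rewrite -[n.+2%:R]natr1 mulrDl mul1r.
exists (M ^+ (Num.truncn (t1 / d)).+1); first by rewrite exprn_gt0.
move=> t y /andP[t0 tt1]; apply: Sn; rewrite t0 (le_trans tt1)//.
by rewrite -ler_pdivrMr// ltW// truncnS_gt.
Qed.

(** Continuity from the left rests on the local bound too: the difference
    [S t y - S s y] is [S s] applied to [S (t - s) y - y]. *)
Lemma semigroup_continuous (y : Y) :
  {within `[0, +oo[, continuous (fun t => S t y)}.
Proof.
apply/within_halfline_continuousP => t0 e t00 e0.
have [M M0 SM] := semigroup_bound (t0 + 1).
have eM : 0 < e / M by rewrite divr_gt0.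
have [d d0 Hd] := near0 y eM.
have step s t : 0 <= s -> s <= t -> t <= t0 + 1 -> t - s < d -> `|S t y - S s y| < e.
  move=> s0 st tt0 ts; rewrite -(subrKC s t) (semigroupD hS) ?subr_ge0// -linearB.
  apply: le_lt_trans (SM _ _ _) _; first by rewrite s0 (le_trans st).
  by rewrite mulrC -ltr_pdivlMr// Hd// subr_ge0 st.
exists (Num.min d 1); first by rewrite lt_min d0 ltr01.
move=> t t0'; rewrite lt_min => /andP[td t1].
have t01 : t <= t0 + 1 by move: t1; rewrite ltr_norml; lra.
have [tt0|t0t] := leP t0 t.
  by apply: step => //; rewrite ger0_norm ?subr_ge0// in td.
rewrite distrC; apply: step => //; [exact: ltW|by rewrite lerDl|].
by rewrite ltr0_norm ?subr_lt0// opprB in td.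
Qed.

(** The vector varies as well, since the input will be approximated by simple
    functions; the local bound makes this harmless. *)
Lemma semigroup_cvg0 (h : nat -> R) (z : nat -> Y) (y : Y) :
  (forall n, 0 <= h n) -> h n @[n --> \oo] --> 0 -> z n @[n --> \oo] --> y ->
  S (h n) (z n) @[n --> \oo] --> y.
Proof.
move=> h0 hc zc; have [M M0 SM] := semigroup_bound 1.
apply/cvgrPdist_lt => e e0; have e2 : 0 < e / 2 by rewrite divr_gt0.
have e2M : 0 < e / 2 / M by rewrite divr_gt0.
have [d d0 Hd] := near0 y e2.
have zy := (cvgrPdist_lt _ _).1 zc _ e2M.
have m0 : 0 < Num.min d 1 by rewrite lt_min d0 ltr01.
have hd := (cvgrPdist_lt _ _).1 hc _ m0.
near=> n; have zn : `|y - z n| < e / 2 / M by near: n; exact: zy.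
have : `|0 - h n| < Num.min d 1 by near: n; exact: hd.
rewrite sub0r normrN ger0_norm// lt_min => /andP[hnd hn1].
rewrite distrC -[_ - _](subrKA (S (h n) y)) -linearB.
rewrite (le_lt_trans (ler_normD _ _))// (splitr e); apply: ltrD.
  apply: le_lt_trans (SM _ _ _) _; first by rewrite h0 ltW.
  by rewrite mulrC -ltr_pdivlMr// distrC.
by apply: Hd; rewrite h0.
Unshelve. all: by end_near. Qed.

(** The times are rounded down to the values of a simple function, so only
    right continuity of the semigroup enters. *)
Lemma simple_limit_orbit (w : measurableTypeR R -> Y) (t : R) :
  simple_limit w ->
  simple_limit (patch (fun=> 0) `[0, t] (fun s : measurableTypeR R => S (t - s) (w s))).
Proof.
move=> [s_ [ss sw]].
pose D : set (measurableTypeR R) := `[0, t]%classic.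
have mD : measurable D by exact: measurable_itv.
have mid : measurable_fun D (fun s : measurableTypeR R => (s : R)%:E).
  by apply/measurable_EFinP; exact: measurable_id.
pose a n : measurableTypeR R -> R := nnsfun_approx mD mid n.
have sa n : simple_function (a n).
  by split; [exact: fimfunP|move=> x; exact: measurable_sfunP].
have Dge0 x : D x -> (0 <= (x : R)%:E)%E.
  by rewrite /D /= in_itv/= lee_fin => /andP[].
have ac x : D x -> a n x @[n --> \oo] --> (x : R).
  by move=> Dx; have := cvg_nnsfun_approx mD mid Dge0 Dx; exact: fine_cvg.
have ale n x : D x -> a n x <= (x : R).
  move=> Dx; have nd : nondecreasing_seq (a ^~ x).
    by move=> m k mk; have /lefP := nd_nnsfun_approx mD mid mk; exact.
  have cv : cvgn (a ^~ x) by apply/cvg_ex; exists (x : R); exact: ac.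
  by have := nondecreasing_cvgn_le nd cv n; rewrite (cvg_lim _ (ac x Dx)).
exists (fun n => patch (fun=> 0) D (fun s => S (t - a n s) (s_ n s))); split=> [n|x].
  apply: simple_patch => //; last exact: simple_cst.
  exact: (simple_comp2 (fun r z => S (t - r) z) (sa n) (ss n)).
rewrite /patch; case: ifPn => [|_]; last exact: cvg_cst.
rewrite inE => Dx; have : 0 <= x <= t by move: (Dx); rewrite /D /= in_itv.
move=> /andP[x0 xt].
have tx : 0 <= t - x by rewrite subr_ge0.
apply: (@cvg_trans _ (S (t - x) (S (x - a n x) (s_ n x)) @[n --> \oo])).
  apply: near_eq_cvg; apply: nearW => n.
  by rewrite -(semigroupD hS) ?subr_ge0 ?ale// subrKA.
apply: (continuous_cvg _ (semigroup_bounded hS tx (x := w x))).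
apply: semigroup_cvg0 => //; first by move=> n; rewrite subr_ge0 ale.
by rewrite -(subrr x); apply: cvgB; [exact: cvg_cst|exact: ac].
Qed.

End semigroup.

(** * The input integral *)

Section input_integral.
Context {R : realType} {U : normedModType R} {Xm : completeNormedModType R}.
Variables (p : \bar R) (Tm : R -> {linear Xm -> Xm}) (B : {linear U -> Xm}).
Hypotheses (p1 : (1 <= p)%E) (hTm : C0_semigroup Tm) (hB : continuous B).
Local Notation mu := (@lebesgue_measure R).
Local Notation I := (input_integral Tm B).
Implicit Types u v : R -> U.

Let integrand (t : R) (v : measurableTypeR R -> U) : measurableTypeR R -> Xm :=
  patch (fun=> 0) `[0, t] (fun s : measurableTypeR R => Tm (t - s) (B (v s))).

Let mitv (a b : itv_bound R) : measurable ([set` Interval a b] : set (measurableTypeR R)).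
Proof. exact: measurable_itv. Qed.

Let mu_itv_fin (b1 b2 : bool) (a b : R) :
  (mu [set` Interval (BSide b1 a) (BSide b2 b)] < +oo)%E.
Proof.
rewrite lebesgue_measure_itv/=; case: ifP => _; last by rewrite ltry.
by rewrite -EFinD ltry.
Qed.

Let mu_point (a : R) : mu `[a, a] = 0%E.
Proof. by rewrite lebesgue_measure_itv/= ltxx. Qed.

Lemma input_integral_causal (t : R) u1 u2 : input_eq `[0, t] u1 u2 ->
  I t u1 = I t u2.
Proof.
move=> u12; apply: ae_eq_Bochner_integral.
by apply: filterS u12 => s e /= s0t; rewrite e.
Qed.

Let integrand_bound (t : R) : exists2 C, 0 <= C & forall u v, 0 <= t ->
  in_Lp p u -> representative u v ->
  simple_limit (integrand t v) /\
  (\int[mu]_(s in `[0%R, t]) `|integrand t v s|%:E <= (C * Lp_norm p u)%:E)%E.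
Proof.
have [M M0 TM] := semigroup_bound hTm t.
have [b b0 Bb] := linear_bound hB.
exists (M * b * (`|t| + 1)); first by rewrite !mulr_ge0// ?ltW// addr_ge0.
move=> u v t0 pu uv; have [sv _ _] := uv.
split; first exact: simple_limit_orbit hTm _ _ (simple_limit_comp hB sv).
apply: (@le_trans _ _ (\int[mu]_(s in `[0%R, t]) ((M * b)%:E * `|v s|%:E))%E).
  apply: ae_le_ge0_integral => // [s _|].
    by rewrite -EFinM lee_fin !mulr_ge0// ltW.
  apply: aeW => s; rewrite /= => s0t; rewrite -EFinM lee_fin /integrand /patch mem_set//=.
  move: s0t; rewrite in_itv/= => /andP[s0 st].
  apply: (le_trans (TM _ _ _)); first by rewrite subr_ge0 st lerBlDr lerDl.
  by rewrite -mulrA ler_pM2l.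
rewrite ge0_integralZl_EFin//; last 2 first.
- exact: simple_limit_measurable_normE.
- by rewrite mulr_ge0// ltW.
have -> : M * b * (`|t| + 1) * Lp_norm p u = (M * b) * ((`|t| + 1) * Lp_norm p u).
  by rewrite !mulrA.
rewrite (EFinM (M * b)) lee_pmul2l ?lte_fin ?mulr_gt0//.
rewrite ger0_norm//; apply: (integral_norm_le_vLnorm p1 t0 sv).
exact: representative_norm.
Qed.

Let integrable_integrand (t : R) u v : 0 <= t -> in_Lp p u ->
  representative u v -> Bochner_integrable mu `[0, t] (integrand t v).
Proof.
move=> t0 pu uv; have [C _ H] := integrand_bound t.
have [si ib] := H u v t0 pu uv.
by split=> //; apply: le_lt_trans ib _; exact: ltry.
Qed.

Let input_integralE (t : R) u v : representative u v ->
  I t u = Bochner_integral mu `[0, t] (integrand t v).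
Proof.
move=> [_ _ uv]; apply: ae_eq_Bochner_integral.
apply: filterS uv => s e /= s0t; rewrite /integrand /patch mem_set//= e//.
by move: s0t; rewrite /= !in_itv/= andbT => /andP[].
Qed.

Lemma input_integralD (t : R) u1 u2 : 0 <= t -> in_Lp p u1 -> in_Lp p u2 ->
  I t (fun s => u1 s + u2 s) = I t u1 + I t u2.
Proof.
move=> t0 pu1 pu2; have [v1 uv1] := in_Lp_representative pu1.
have [v2 uv2] := in_Lp_representative pu2.
rewrite (input_integralE t uv1) (input_integralE t uv2).
rewrite (input_integralE t (representativeD uv1 uv2)).
have i1 := integrable_integrand t0 pu1 uv1.
have i2 := integrable_integrand t0 pu2 uv2.
rewrite -(Bochner_integralD (mitv _ _) (mu_itv_fin _ _ _ _) i1 i2).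
congr Bochner_integral; apply/funext => s; rewrite /integrand /patch.
by case: ifP => _; rewrite ?addr0// !linearD.
Qed.

Lemma input_integralZ (t a : R) u : 0 <= t -> in_Lp p u ->
  I t (fun s => a *: u s) = a *: I t u.
Proof.
move=> t0 pu; have [v uv] := in_Lp_representative pu.
rewrite (input_integralE t uv) (input_integralE t (representativeZ a uv)).
pose L : {linear Xm -> Xm} := a \*: (idfun : {linear Xm -> Xm}).
have cL : continuous L by exact: scaler_continuous.
have iu := integrable_integrand t0 pu uv.
rewrite -[RHS]/(L _) -(Bochner_integral_linear (mitv _ _) (mu_itv_fin _ _ _ _) cL iu).
congr Bochner_integral; apply/funext => s; rewrite /integrand /patch /=.
by case: ifP => _; rewrite ?scaler0// !linearZ.
Qed.

Lemma input_integral_bound (t : R) : 0 <= t ->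
  exists2 C, 0 <= C & forall u, in_Lp p u -> `|I t u| <= C * Lp_norm p u.
Proof.
move=> t0; have [C C0 H] := integrand_bound t; exists C => // u pu.
have [v uv] := in_Lp_representative pu.
rewrite (input_integralE t uv) -lee_fin; apply: le_trans (H u v t0 pu uv).2.
by apply: Bochner_integral_norm; [exact: mitv|exact: mu_itv_fin|
  exact: integrable_integrand pu _].
Qed.

Lemma input_integral0 u : in_Lp p u -> I 0 u = 0.
Proof.
move=> pu; have [v uv] := in_Lp_representative pu.
rewrite (input_integralE 0 uv); apply: Bochner_integral_null.
- exact: mitv.
- exact: mu_point.
by have [] := integrable_integrand (lexx 0) pu uv.
Qed.

(** The integral over [[0, t + s]] splits at time [s]: on the first part the
    operator [Tm t] comes out, and the second part is a translation by [s]. *)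
Lemma input_integral_cocycle (s t : R) u : 0 <= s -> 0 <= t -> in_Lp p u ->
  I (t + s) u = Tm t (I s u) + I t (shift_input s u).
Proof.
move=> s0 t0 pu; have [v uv] := in_Lp_representative pu.
have [ps _] := shift_input_Lp p1 pu s0.
have rs := representative_shift s0 uv.
have ts0 : 0 <= t + s by exact: addr_ge0.
set v' := patch _ _ _ in rs.
rewrite (input_integralE _ uv) (input_integralE _ uv) (input_integralE _ rs).
have iu := integrable_integrand ts0 pu uv.
have is_ := integrable_integrand s0 pu uv.
have it := integrable_integrand t0 ps rs.
have E1 : (`[0, t + s]%classic : set (measurableTypeR R)) = `[0, s]%classic `|` `]s, t + s]%classic.
  apply/seteqP; split=> x /=; rewrite !in_itv/=.
    by move=> /andP[-> ->]; case: leP => _; [left|right].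
  by move=> [/andP[-> xs]|/andP[sx ->]] /=; [rewrite (le_trans xs)// lerDr|
    rewrite andbT (le_trans s0)// ltW].
(* The translate of the second part misses the endpoint 0, a null set. *)
have E2 : (`[0, t]%classic : set (measurableTypeR R)) = `[0, 0]%classic `|` `]0, t]%classic.
  apply/seteqP; split=> x /=; rewrite !in_itv/=.
    by move=> /andP[x0 ->]; rewrite andbT x0; case: leP => _; [left|right].
  by move=> [/andP[-> x0]|/andP[x0 ->]] /=; [rewrite (le_trans x0)|
    rewrite andbT ltW].
have disj (a b c : R) : [disjoint `[a, b]%classic & `]b, c]%classic].
  apply/disj_set2P; rewrite -subset0 => x /=; rewrite !in_itv/=.
  by move=> [/andP[_ xb] /andP[bx _]]; have := le_lt_trans xb bx; rewrite ltxx.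
rewrite E1 Bochner_integral_setU; [|exact: mitv|exact: mitv|exact: disj|
  exact: mu_itv_fin|exact: mu_itv_fin|by rewrite -E1].
congr (_ + _).
  rewrite -Bochner_integral_linear; [|exact: mitv|exact: mu_itv_fin|
    exact: semigroup_bounded|by []].
  apply: ae_eq_Bochner_integral; apply: aeW => x xs; rewrite /integrand /patch /=.
  move: (xs); rewrite /= in_itv/= => /andP[x0 xs'].
  rewrite (mem_set xs) mem_set; last by rewrite /= in_itv/= x0 (le_trans xs')// lerDr.
  by rewrite -(semigroupD hTm) ?subr_ge0// addrA.
rewrite E2 Bochner_integral_setU; [|exact: mitv|exact: mitv|exact: disj|
  exact: mu_itv_fin|exact: mu_itv_fin|by rewrite -E2].
rewrite (Bochner_integral_null (mitv (BLeft 0) (BRight 0))); last 2 first.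
- exact: mu_point.
- exact: it.1.
rewrite add0r -(Bochner_integral_translation s (mitv _ _)); last 2 first.
- exact: mu_itv_fin.
- apply: Bochner_integrableS iu; [exact: mitv..|].
  by rewrite E1; right.
have -> : ((fun x : R => x + s) @^-1` `]s, t + s]%classic :
    set (measurableTypeR R)) = `]0, t]%classic.
  by apply/seteqP; split=> x /=; rewrite !in_itv/= lerD2r -ltrBlDr subrr.
apply: ae_eq_Bochner_integral; apply: aeW => x /=; rewrite in_itv/= => /andP[x0 xt].
rewrite /integrand /patch.
rewrite mem_set/=; last by rewrite in_itv/= lerD2r xt andbT addr_ge0// ltW.
rewrite mem_set/=; last by rewrite in_itv/= xt andbT ltW.
rewrite /v' /patch mem_set/=; last by rewrite in_itv/= ltW.
by rewrite opprD addrACA subrr addr0.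
Qed.

End input_integral.

(** * Linear systems with an admissible control operator *)

Section control_system.
Context {R : realType} {X U : completeNormedModType R}.
Variables (p : \bar R) (T : R -> {linear X -> X}) (DA : set X) (A : X -> X)
  (lambda : R) (Rl : {linear X -> X}) (Xm : completeNormedModType R)
  (j : {linear X -> Xm}) (Tm : R -> {linear Xm -> Xm}) (B : {linear U -> Xm}).
Hypotheses (p1 : (1 <= p)%E) (hT : C0_semigroup T) (hA : is_generator T DA A)
  (hRl : is_resolvent DA A lambda Rl) (hXm : is_extrapolation_space Rl j)
  (hTm : is_extended_semigroup j T Tm) (hB : continuous B)
  (hadm : admissible j Tm (in_Lp p) B).
Local Notation mu := (@lebesgue_measure R).
Local Notation Phi := (input_map j Tm B).
Local Notation N := (Lp_norm p).
Implicit Types u v : R -> U.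

(** If [j x] vanishes then so does [Rl x], and then also [x], which is
    [lambda *: Rl x - A (Rl x)]; the generator maps [0] to [0]. *)
Lemma embedding_injective : injective j.
Proof.
move=> x y jxy; apply/eqP; rewrite -subr_eq0; apply/eqP.
set z := x - y.
have Rz : Rl z = 0.
  by apply/eqP; rewrite -normr_eq0 -hXm.1 /z linearB jxy subrr normr0.
have [_ /(_ z)[Dz Az] _] := hRl.
rewrite Rz scaler0 sub0r in Az; rewrite Rz in Dz.
have h0 : h^-1 *: (T h 0 - 0) @[h --> 0^'+] --> (0 : X).
  apply: (@cvg_trans _ ((0 : X) @[_ --> 0^'+])); last exact: cvg_cst.
  apply: near_eq_cvg; apply: nearW => h.
  by rewrite linear0 subrr scaler0.
have [_ A0] := (hA 0 0).2 h0.
by rewrite -Az A0 oppr0.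
Qed.

(** A vector [x] is the limit of operators applied to [Rl x], and
    [`|Rl x| = `|j x|]: in the Yosida manner, this recovers the norm of [X] from
    the weaker norm of [Xm]. *)
Lemma resolvent_approx (x : X) :
  lambda *: Rl x - n.+1%:R *: (T n.+1%:R^-1 (Rl x) - Rl x) @[n --> \oo] --> x.
Proof.
have [_ /(_ x)[Dx xE] _] := hRl.
rewrite -[X in _ --> X]xE; apply: cvgB; first exact: cvg_cst.
have h := (hA (Rl x) (A (Rl x))).1 (conj Dx erefl).
have hn : (n.+1%:R^-1 : R) @[n --> \oo] --> 0^'+.
  move=> P [d /= d0 HP]; suff : \forall n \near \oo, P n.+1%:R^-1 by [].
  near=> n; have n0 : 0 < n.+1%:R^-1 :> R by rewrite invr_gt0.
  apply: HP; last exact: n0.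
  rewrite /= sub0r normrN ger0_norm//.
  by near: n; exact: near_infty_natSinv_lt (PosNum d0).
apply: cvg_trans (cvg_comp _ _ hn h); apply: near_eq_cvg; apply: nearW => n.
by rewrite /= invrK.
Unshelve. all: by end_near. Qed.

Lemma input_mapE (t : R) u : 0 <= t -> in_Lp p u ->
  j (Phi t u) = input_integral Tm B t u.
Proof.
move=> t0 pu; have [x _ xE] := hadm t0 pu.
by rewrite /input_map; case: xgetP => [y _ //|/(_ x)]; rewrite /= xE.
Qed.

Lemma input_mapD (t : R) u1 u2 : 0 <= t -> in_Lp p u1 -> in_Lp p u2 ->
  Phi t (u1 + u2) = Phi t u1 + Phi t u2.
Proof.
move=> t0 pu1 pu2; have pu : in_Lp p (u1 + u2) := (in_LpD_norm p1 pu1 pu2).1.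
apply: embedding_injective; rewrite [RHS](linearD j).
apply: etrans (input_mapE t0 pu) _.
apply: etrans (input_integralD p1 hTm.1 hB t0 pu1 pu2) _.
by congr (_ + _); apply/esym; exact: input_mapE.
Qed.

Lemma input_mapZ (t a : R) u : 0 <= t -> in_Lp p u ->
  Phi t (a *: u) = a *: Phi t u.
Proof.
move=> t0 pu; have pau : in_Lp p (a *: u) := (in_LpZ_norm p1 a pu).1.
apply: embedding_injective; rewrite [RHS](linearZ_LR j).
apply: etrans (input_mapE t0 pau) _.
apply: etrans (input_integralZ p1 hTm.1 hB a t0 pu) _.
by congr (_ *: _); apply/esym; exact: input_mapE.
Qed.

Lemma input_map_causal (t : R) u1 u2 : 0 <= t -> in_Lp p u1 -> in_Lp p u2 ->
  input_eq `[0, t] u1 u2 -> Phi t u1 = Phi t u2.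
Proof.
move=> t0 pu1 pu2 u12; apply: embedding_injective.
apply: etrans (input_mapE t0 pu1) (etrans _ (esym (input_mapE t0 pu2))).
exact: input_integral_causal.
Qed.

Lemma input_map_time0 u : in_Lp p u -> Phi 0 u = 0.
Proof.
move=> pu; apply: embedding_injective; rewrite (linear0 j).
exact: etrans (input_mapE (lexx 0) pu) (input_integral0 p1 hTm.1 hB pu).
Qed.

Lemma input_map0 (t : R) : 0 <= t -> Phi t (fun=> 0) = 0.
Proof.
move=> t0; rewrite -[LHS]scale1r -(scale0r (Phi t (fun=> 0))).
rewrite scale1r -(input_mapZ 0 t0 (in_Lp0 p1)); congr input_map.
by apply/funext => s; rewrite scale0r.
Qed.

Lemma input_map_cocycle (s t : R) u : 0 <= s -> 0 <= t -> in_Lp p u ->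
  Phi (t + s) u = T t (Phi s u) + Phi t (shift_input s u).
Proof.
move=> s0 t0 pu; have [ps _] := shift_input_Lp p1 pu s0.
apply: embedding_injective; rewrite (linearD j) -(hTm.2 _ _ t0).
apply: etrans (input_mapE (addr_ge0 t0 s0) pu) _.
apply: etrans (input_integral_cocycle p1 hTm.1 hB s0 t0 pu) _.
by congr (Tm t _ + _); apply/esym; exact: input_mapE.
Qed.

(** This replaces the closed graph theorem: [resolvent_approx] makes [Phi t] a
    pointwise limit of operators bounded from L^p to [X]. *)
Lemma input_map_bounded_at (t : R) : 0 <= t ->
  exists2 K, 0 <= K & forall u, in_Lp p u -> `|Phi t u| <= K * N u.
Proof.
move=> t0.
pose G n x := lambda *: Rl x - n.+1%:R *: (T n.+1%:R^-1 (Rl x) - Rl x).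
have GD n x y : G n (x + y) = G n x + G n y.
  rewrite /G (linearD Rl) (linearD (T _)) opprD addrACA (scalerDr lambda).
  by rewrite (scalerDr n.+1%:R) opprD addrACA.
have GZ n a x : G n (a *: x) = a *: G n x.
  rewrite /G (linearZ_LR Rl) (linearZ_LR (T _)) -scalerBr [RHS]scalerBr !scalerA.
  by rewrite (mulrC lambda) (mulrC n.+1%:R).
have [C C0 IC] := input_integral_bound p1 hTm.1 hB t0.
have RlPhi u : in_Lp p u -> `|Rl (Phi t u)| <= C * N u.
  move=> pu; rewrite -hXm.1.
  by have := IC u pu; rewrite -(input_mapE t0 pu).
have [n u v pu pv|n a u pu|n|u pu|K K0 HK] :=
  @Lp_uniform_boundedness _ _ p p1 _ nat (fun n u => G n (Phi t u)).
- by rewrite (input_mapD t0 pu pv) GD.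
- by rewrite (input_mapZ a t0 pu) GZ.
- have n0 : 0 <= n.+1%:R^-1 :> R by rewrite invr_ge0.
  have [M M0 TM] := linear_bound (semigroup_bounded hT n0).
  exists ((`|lambda| + n.+1%:R * (M + 1)) * C) => u pu.
  rewrite -mulrA; apply: le_trans (ler_normB _ _) _; rewrite mulrDl; apply: lerD.
    by rewrite normrZ ler_wpM2l// RlPhi.
  rewrite normrZ ger0_norm// -mulrA ler_wpM2l// mulrDl mul1r.
  apply: le_trans (ler_normB _ _) _; apply: lerD; last exact: RlPhi.
  by apply: le_trans (TM _) _; rewrite ler_pM2l// RlPhi.
- have cv : cvgn (fun n => `|G n (Phi t u)|).
    by apply/cvg_ex; exists `|Phi t u|; apply: cvg_norm; exact: resolvent_approx.
  have [M [_ HM]] := cvg_seq_bounded cv.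
  have M1 : M < M + 1 by rewrite ltrDl.
  exists (M + 1) => n; have /= := HM (M + 1) M1 n I.
  by rewrite normr_id.
exists K => // u pu.
have cG : `|G n (Phi t u)| @[n --> \oo] --> `|Phi t u|.
  by apply: cvg_norm; exact: resolvent_approx.
by apply: (cvgr_to_le cG); apply: nearW => n; exact: HK.
Qed.

Definition delay (h : R) u : R -> U := concat_input h (fun=> 0) u.

Lemma delay_representative (h : R) u (v : measurableTypeR R -> U) : 0 <= h ->
  representative u v -> representative (delay h u) (fun t => v (t - h)).
Proof.
move=> h0 uv; have := representative_concat h0 representative0 uv.
congr (representative _ _); apply/funext => t.
by rewrite /patch if_same add0r.
Qed.

Lemma delay_Lp (h : R) u : 0 <= h -> in_Lp p u ->
  in_Lp p (delay h u) /\ N (delay h u) <= N u.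
Proof.
move=> h0 pu; have [v uv] := in_Lp_representative pu.
apply: (representative_norm_le p1 (delay_representative h0 uv)).
by have [sv _ _] := uv; rewrite vLnorm_translation// (representative_norm p1 pu uv).
Qed.

Lemma input_map_delay (h t : R) u : 0 <= h -> 0 <= t -> in_Lp p u ->
  Phi (t + h) (delay h u) = Phi t u.
Proof.
move=> h0 t0 pu; have [pd _] := delay_Lp h0 pu.
have p0 : in_Lp p (fun=> 0 : U) by exact: in_Lp0.
rewrite (input_map_cocycle h0 t0 pd) (input_map_causal h0 pd p0); last first.
  exists [set h]; split; [exact: measurable_set1|exact: lebesgue_measure_set1|].
  move=> s /= /not_implyP[]; rewrite in_itv/= => /andP[_ sh].
  apply: contra_notP => /eqP snh.
  by rewrite /delay /concat_input lt_neqAle snh sh.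
rewrite (input_map0 h0) (linear0 (T t)) add0r.
have [ps _] := shift_input_Lp p1 pd h0.
apply: (input_map_causal t0 ps pu); apply: aeW => s /=; rewrite in_itv/= => /andP[s0 _].
by rewrite /shift_input /delay /concat_input ltNge lerDr s0/= addrK.
Qed.

(** Delaying the input to make it end at time [t1] does not raise its norm, so
    the bound at time [t1] serves all earlier times. *)
Lemma input_map_bounded (t1 : R) : 0 <= t1 ->
  exists2 K, 0 <= K &
    forall t u, 0 <= t <= t1 -> in_Lp p u -> `|Phi t u| <= K * N u.
Proof.
move=> t10; have [K K0 HK] := input_map_bounded_at t10.
exists K => // t u /andP[t0 tt1] pu.
have h0 : 0 <= t1 - t by rewrite subr_ge0.
have [pd Nd] := delay_Lp h0 pu.
rewrite -(input_map_delay h0 t0 pu) subrKC.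
by apply: le_trans (HK _ pd) _; rewrite ler_wpM2l.
Qed.

(** The increment of [Phi] between times [s] and [t] is the value of [Phi t] at
    the difference of [u] and its delay by [t - s], which is small in L^p. *)
Lemma input_map_continuous u : (p < +oo)%E -> in_Lp p u ->
  {within `[0, +oo[, continuous (fun t => Phi t u)}.
Proof.
move=> py pu; have [v uv] := in_Lp_representative pu; have [sv _ _] := uv.
have pr : p = (fine p)%:E by rewrite fineK// ge0_fin_numE// (le_trans _ p1).
have r1 : 1 <= fine p by rewrite -lee_fin -pr.
have vfin : (vLnorm mu (fine p)%:E v < +oo)%E.
  by rewrite -pr (representative_norm p1 pu uv) ltry.
have vtr := vLnorm_translation_continuous r1 sv vfin.
apply/within_halfline_continuousP => t0 e t00 e0.
have t010 : 0 <= t0 + 1 by rewrite addr_ge0.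
have [K K0 HK] := input_map_bounded t010.
have K1 : 0 < K + 1 by rewrite ltr_wpDl.
have e'0 : 0 < e / (K + 1) by rewrite divr_gt0.
have [d /= d0 Hd] := vtr _ e'0.
have step s t : 0 <= s -> s <= t -> t <= t0 + 1 -> t - s < d ->
    `|Phi s u - Phi t u| < e.
  move=> s0 st tt0 tsd; set h := t - s.
  have h0 : 0 <= h by rewrite subr_ge0.
  have [pd _] := delay_Lp h0 pu.
  have tE : s + h = t by rewrite subrKC.
  have tge0 : 0 <= t by exact: le_trans st.
  have pNu : in_Lp p (-1 *: u) := (in_LpZ_norm p1 (-1) pu).1.
  rewrite -(input_map_delay h0 s0 pu) tE -scaleN1r -(input_mapZ _ tge0 pu).
  rewrite -(input_mapD tge0 pd pNu).
  have rd := representativeD (delay_representative h0 uv) (representativeZ (-1) uv).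
  have [pw Nw] : in_Lp p (delay h u + -1 *: u) /\ N (delay h u + -1 *: u) <= e / (K + 1).
    apply: (representative_norm_le p1 rd); rewrite pr.
    have : `|0 - - h| < d by rewrite sub0r opprK ger0_norm.
    move=> /Hd; congr (_ <= _)%E; congr vLnorm.
    by apply/funext => x; rewrite scaleN1r.
  apply: le_lt_trans (HK t _ _ pw) _; first by rewrite (le_trans s0).
  apply: (@le_lt_trans _ _ (K * (e / (K + 1)))); first by rewrite ler_wpM2l.
  by rewrite mulrCA gtr_pMr// ltr_pdivrMr// mul1r ltrDl.
exists (Num.min d 1); first by rewrite lt_min d0 ltr01.
move=> t t0'; rewrite lt_min => /andP[td t1].
have t01 : t <= t0 + 1 by move: t1; rewrite ltr_norml; lra.
have [tt0|t0t] := leP t0 t.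
  rewrite distrC; apply: step => //.
  by rewrite ger0_norm ?subr_ge0// in td.
apply: step => //; [exact: ltW|by rewrite lerDl|].
by rewrite ltr0_norm ?subr_lt0// opprB in td.
Qed.

Hypothesis hinf : p = +oo%E -> forall u, in_Lp p u ->
  {within `[0, +oo[, continuous (fun t : R => Phi t u)}.

Lemma mild_flow_dynamical_system :
  dynamical_system (in_Lp p) N (mild_flow T j Tm B).
Proof.
split.
- by exists (fun=> 0); exact: in_Lp0.
- by exists (in_Lp p); split=> //; exact: Lp_norm_is_norm.
- by move=> u tau; exact: shift_input_Lp.
- by move=> u1 u2 tau; exact: concat_input_Lp.
- move=> x0 u pu.
  by rewrite /mild_flow (semigroup0 hT) (input_map_time0 pu) addr0.
- move=> x0 u s t pu s0 t0.
  rewrite /mild_flow (semigroupD hT x0 t0 s0) (input_map_cocycle s0 t0 pu).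
  by rewrite [in RHS](linearD (T t)) addrA.
- move=> x0 u pu t; apply: cvgD; first exact: semigroup_continuous.
  have [py|py] := eqVneq p +oo%E; first exact: hinf.
  by apply: input_map_continuous; rewrite // ltey.
move=> x0 u1 u2 tau pu1 pu2 tau0 u12 t /andP[t0 ttau].
rewrite /mild_flow (input_map_causal t0 pu1 pu2)//.
apply: filterS u12 => s e st; apply: e; move: st.
by rewrite /= !in_itv/= => /andP[-> st] /=; exact: le_trans ttau.
Qed.

Lemma class_K_linear (c : R) : 0 < c -> class_K (fun s : R => c * s).
Proof.
move=> c0; split; last by rewrite mulr0.
  by apply: continuous_subspaceT => s; exact: mulrl_continuous.
by move=> r s _ _ rs; rewrite ltr_pM2l.
Qed.

(** By homogeneity, stability near the origin for the zero input bounds the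
    semigroup. The weak asymptotic gain bounds [Phi t u] for large [t], and
    [input_map_bounded] for the other [t]; the uniform boundedness principle
    then makes the bound linear in the norm of [u]. *)
Lemma weakly_ISS_equiv :
  weakly_ISS (in_Lp p) N (mild_flow T j Tm B) <->
  zero_input_uniformly_locally_stable (in_Lp p) N (mild_flow T j Tm B) /\
  weak_asymptotic_gain (in_Lp p) N (mild_flow T j Tm B).
Proof.
have p0 : in_Lp p (fun=> 0 : U) by exact: in_Lp0.
split=> [[[sigma [gamma [Ks Kg H]]] wag]|].
  split=> //; split=> //; exists sigma, gamma, 1; split=> // x0 u -> _ _.
  exact: H.
move=> [[_ [sigma [gamma [r [Ks Kg r0 H]]]]] wag]; split=> //.
have N0 : N (fun=> 0 : U) = 0.
  have [_ e] := in_LpZ_norm p1 0 p0; rewrite normr0 mul0r in e.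
  apply: etrans e.
  by congr (Lp_norm p _); apply/funext => s; rewrite scale0r.
have flow0 t x : 0 <= t -> mild_flow T j Tm B t x (fun=> 0 : U) = T t x.
  by move=> t0; rewrite /mild_flow input_map0// addr0.
have [_ sigma_mono sigma0] := Ks; have [_ _ gamma0] := Kg.
have sr : 0 < sigma r.
  by rewrite -sigma0; apply: sigma_mono; rewrite ?in_itv/= ?lexx ?ltW.
pose M := sigma r / r; have M0 : 0 < M by rewrite divr_gt0.
have TM t x : 0 <= t -> `|T t x| <= M * `|x|.
  move=> t0; have [->|x0] := eqVneq x 0; first by rewrite linear0 normr0 mulr0.
  have nx : 0 < `|x| by rewrite normr_gt0.
  have rx : 0 <= r / `|x| by rewrite divr_ge0// ltW.
  have nr : `|(r / `|x|) *: x| = r by rewrite normrZ ger0_norm// divfK// gt_eqF.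
  have := H ((r / `|x|) *: x) (fun=> 0) erefl; rewrite nr N0.
  move=> /(_ (lexx _) (ltW r0) t t0); rewrite flow0// N0 gamma0 addr0 nr.
  rewrite (linearZ_LR (T t)) normrZ ger0_norm// => h.
  by rewrite /M mulrAC ler_pdivlMr// mulrC -ler_pdivrMr// mulrAC.
have [gamma' _ wagE] := wag.
(* The absolute value makes the whole line the index set of the family. *)
have [K K0 PhiK] : exists2 K : R, 0 <= K &
    forall (t : R) u, in_Lp p u -> `|Phi `|t| u| <= K * N u.
  apply: (Lp_uniform_boundedness p1 (F := fun t u => Phi `|t| u)).
  - by move=> t u v pu pv; exact: input_mapD.
  - by move=> t a u pu; exact: input_mapZ.
  - by move=> t; have [C _ HC] := input_map_bounded_at (normr_ge0 t); exists C.
  move=> u pu; have [tau tau0 Htau] := wagE 1 0 u ltr01 pu.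
  have [C C0 HC] := input_map_bounded tau0.
  exists (1 + gamma' (N u) + C * N u) => t.
  have [taut|ttau] := leP tau `|t|.
    have := Htau _ taut; rewrite /mild_flow linear0 add0r => /le_trans; apply.
    by rewrite lerDl mulr_ge0 ?Lp_norm_ge0.
  have := HC `|t| u; rewrite normr_ge0 (ltW ttau) => /(_ isT pu) /le_trans; apply.
  have := Htau _ (lexx _); move=> /(le_trans (normr_ge0 _)) h.
  by rewrite lerDr.
exists (fun s => M * s), (fun s => (K + 1) * s); split.
- exact: class_K_linear.
- by apply: class_K_linear; rewrite ltr_wpDl.
move=> x u pu t t0; apply: le_trans (ler_normD _ _) _; apply: lerD.
  exact: TM.
have := PhiK t u pu; rewrite (ger0_norm t0) => /le_trans; apply.
by rewrite ler_wpM2r ?Lp_norm_ge0// lerDl.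
Qed.

End control_system.

Theorem proposition5p2 (R : realType) (X U : completeNormedModType R)
    (p : \bar R) (T : R -> {linear X -> X}) (DA : set X) (A : X -> X)
    (lambda : R) (Rl : {linear X -> X})
    (Xm : completeNormedModType R) (j : {linear X -> Xm})
    (Tm : R -> {linear Xm -> Xm}) (B : {linear U -> Xm})
    (hp : (1 <= p)%E)
    (hT : C0_semigroup T)
    (hA : is_generator T DA A)
    (hRl : is_resolvent DA A lambda Rl)
    (hXm : is_extrapolation_space Rl j)
    (hTm : is_extended_semigroup j T Tm)
    (hB : continuous B)
    (hadm : admissible j Tm (in_Lp p) B)
    (hinf : p = +oo%E -> forall u : R -> U, in_Lp p u ->
      {within `[0, +oo[, continuous (fun t : R => input_map j Tm B t u)}) :
  dynamical_system (in_Lp p) (Lp_norm p) (mild_flow T j Tm B) /\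
  (weakly_ISS (in_Lp p) (Lp_norm p) (mild_flow T j Tm B) <->
   zero_input_uniformly_locally_stable
     (in_Lp p) (Lp_norm p) (mild_flow T j Tm B) /\
   weak_asymptotic_gain (in_Lp p) (Lp_norm p) (mild_flow T j Tm B)).
Proof.
split; first exact: (mild_flow_dynamical_system hp hT hA hRl hXm hTm hB hadm hinf).
exact: (weakly_ISS_equiv hp hT hA hRl hXm hTm hB hadm).
Qed.
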